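(* Let $k$ be an algebraically closed field, $A=kQ$ the path algebra of a finite quiver $Q$, $T$ a finite-dimensional left $A$-module, and $B=A[T]$ the one-point extension of $A$ by $T$. For finite-dimensional $A[T]$-modules $\tilde M=(M,V,f:T\otimes_kV\to M)$ and $\tilde N=(N,W,g:T\otimes_kW\to N)$ we have \[ \dim\mathrm{Der}_{\tilde R}\big(B,\mathrm{Hom}_{\tilde R}(\tilde N,\tilde M)\big)=\dim\mathrm{Der}_R\big(A,\mathrm{Hom}_R(N,M)\big)+\dim W\cdot\langle T,M\rangle_A+\dim\mathrm{Ext}^1_A(\ker g,M). \] Here $\langle\cdot,\cdot\rangle_A$ denotes the homological Euler form of $A$.
   Context: $A[T]$ is the $k$-algebra of formal matrices $\begin{pmatrix} a & t\\ 0&\lambda\end{pmatrix}$ with $a\in A$, $t\in T$, $\lambda\in k$, with componentwise addition and formal matrix multiplication. Left $A[T]$-modules are identified with triples $(M,V,f)$ where $M$ is a left $A$-module, $V$ a $k$-vector space and $f:T\otimes_kV\to M$ an $A$-module map; a morphism $(M,V,f)\to(N,W,g)$ is a pair $(\varphi_1:M\to N\text{ $A$-linear},\ \varphi_2:V\to W\text{ $k$-linear})$ with $\varphi_1f=g(\mathrm{id}_T\otimes\varphi_2)$. $R\subseteq A$ is the semisimple subalgebra spanned by the trivial paths $e_1,\dots,e_n$; $\tilde R\subseteq A[T]$ is the subalgebra spanned by the idempotents $\begin{pmatrix} e_i&0\\0&0\end{pmatrix}$ and $\begin{pmatrix}0&0\\0&1\end{pmatrix}$. For a $k$-algebra $B$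 with subalgebra $S$ and a $B$-bimodule structure on $\mathrm{Hom}_k(\tilde N,\tilde M)$ induced by $B$-modules $\tilde N,\tilde M$, $\mathrm{Der}_S(B,\mathrm{Hom}_S(\tilde N,\tilde M))$ denotes the $k$-space of derivations $\delta:B\to\mathrm{Hom}_k(\tilde N,\tilde M)$ vanishing on $S$; it fits into the exact sequence $0\to\mathrm{Hom}_B(\tilde N,\tilde M)\to\mathrm{Hom}_S(\tilde N,\tilde M)\to\mathrm{Der}_S(B,\mathrm{Hom}_S(\tilde N,\tilde M))\to\mathrm{Ext}^1_B(\tilde N,\tilde M)\to0$ for $S=\tilde R$ (and similarly for $A$ and $R$). $\langle T,M\rangle_A=\dim\mathrm{Hom}_A(T,M)-\dim\mathrm{Ext}^1_A(T,M)$. *)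

(* Defs.v *)
From HB Require Import structures.
From mathcomp Require Import all_boot all_order all_algebra.
From mathcomp Require Import finmap boolp classical_sets functions.
From mathcomp Require Import monalg.

Set Implicit Arguments.
Unset Strict Implicit.
Unset Printing Implicit Defensive.

Import GRing.Theory.
Local Open Scope ring_scope.

(* A quotient U/V of subspaces of a possibly infinite-dimensional X has
   dimension d when the classes of some x_1, ..., x_d in U form a basis. *)
Section Dimension.
Variables (k : fieldType) (X : lmodType k).
Implicit Types U V : set X.

Definition is_qdim U V (d : nat) : Prop :=
  exists x : 'I_d -> X, (forall i, U (x i)) /\
    forall u, U u -> exists! c : 'rV[k]_d, V (u - \sum_i c 0 i *: x i).

Definition finite_qdim U V : Prop := exists d, is_qdim U V d.

(* 0 when U/V is not finite-dimensional; well defined by qdimP. *)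
Definition qdim U V : nat := xget 0%N [set d | is_qdim U V d]%classic.

Definition finite_dimk U : Prop := finite_qdim U [set 0]%classic.
Definition dimk U : nat := qdim U [set 0]%classic.

Definition is_subspace V : Prop :=
  V 0 /\ forall (c : k) u v, V u -> V v -> V (c *: u + v).

Lemma is_qdim_leq U V d e :
  is_subspace V -> is_qdim U V d -> is_qdim U V e -> (d <= e)%N.
Proof.
move=> [V0 VL] [x [xU xB]] [y [yU yB]].
have [C HC] : exists C : 'M[k]_(d, e), forall i, V (x i - \sum_j C i j *: y j).
  have /choice [C HC] i : exists c : 'rV[k]_e, V (x i - \sum_j c 0 j *: y j).
    by have [c [Hc _]] := yB _ (xU i); exists c.
  exists (\matrix_(i, j) C i 0 j) => i.
  by under eq_bigr do rewrite mxE; exact: HC.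
have [D HD] : exists D : 'M[k]_(e, d), forall j, V (y j - \sum_i D j i *: x i).
  have /choice [D HD] j : exists c : 'rV[k]_d, V (y j - \sum_i c 0 i *: x i).
    by have [c [Hc _]] := xB _ (yU j); exists c.
  exists (\matrix_(i, j) D i 0 j) => i.
  by under eq_bigr do rewrite mxE; exact: HD.
have VS (c : 'I_e -> k) (v : 'I_e -> X) :
    (forall j, V (v j)) -> V (\sum_j c j *: v j).
  by move=> Vv; elim/big_rec: _ => // j z _ Vz; apply: VL.
suff CD : C *m D = 1%:M.
  exact: mulmx1_min CD.
apply/row_matrixP => i.
have [c [_ cU]] := xB _ (xU i).
have -> : row i 1%:M = c.
  apply/esym/cU; rewrite (bigD1 i) //= !mxE eqxx scale1r big1 ?addr0 ?subrr //.
  by move=> l nl; rewrite !mxE eq_sym (negPf nl) scale0r.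
apply/esym/cU.
have -> : x i - \sum_l row i (C *m D) 0 l *: x l
    = 1 *: (x i - \sum_j C i j *: y j)
      + \sum_j C i j *: (y j - \sum_l D j l *: x l).
  rewrite scale1r -addrA; congr (_ + _).
  have -> : \sum_j C i j *: (y j - \sum_l D j l *: x l)
      = \sum_j C i j *: y j - \sum_j \sum_l (C i j * D j l) *: x l.
    rewrite -sumrB; apply: eq_bigr => j _; rewrite scalerBr scaler_sumr.
    by under [in RHS]eq_bigr do rewrite -scalerA.
  rewrite addrA addNr add0r; congr (- _).
  rewrite exchange_big /=; apply: eq_bigr => l _.
  by rewrite !mxE scaler_suml.
by apply: VL => //; apply: VS.
Qed.

Lemma qdimP U V d : is_subspace V -> is_qdim U V d -> qdim U V = d.
Proof.
move=> sV Hd; rewrite /qdim; case: xgetP => [e _ /= He|/(_ d) //].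
by apply/eqP; rewrite eqn_leq (is_qdim_leq sV He Hd) (is_qdim_leq sV Hd He).
Qed.

End Dimension.

(* Unlike algType, the zero algebra (the path algebra of a quiver without
   vertices) is allowed. *)
Record kalgebra (k : fieldType) := KAlgebra {
  kalg_ring :> pzRingType;
  kscal : {rmorphism k -> kalg_ring};
  kscalC : forall (c : k) (b : kalg_ring), kscal c * b = b * kscal c }.
Arguments kscal {k} B : rename.

Section FiniteDimensionalModules.
Variables (k : fieldType) (B : kalgebra k).

(* The carrier is canonically a k-space, so the action of B is a separate
   operation rather than an lmodType structure. *)
Record fdmod := FDMod {
  fd_space :> vectType k;
  act : B -> fd_space -> fd_space;
  actDl : forall a b m, act (a + b) m = act a m + act b m;
  actDr : forall a m n, act a (m + n) = act a m + act a n;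
  actM : forall a b m, act (a * b) m = act a (act b m);
  act1 : forall m, act 1 m = m;
  actZ : forall (c : k) m, act (kscal B c) m = c *: m }.

Lemma act_linear (M : fdmod) (b : B) : linear (@act M b).
Proof.
by move=> c m n; rewrite actDr -!(@actZ M) -!actM kscalC.
Qed.
HB.instance Definition _ (M : fdmod) (b : B) :=
  GRing.isLinear.Build k M M *:%R (@act M b) (@act_linear M b).

Lemma act0l (M : fdmod) (m : M) : act (0 : B) m = 0.
Proof. by apply: (addIr (act (0 : B) m)); rewrite -actDl !add0r. Qed.

Definition Hom (N M : fdmod) : set 'Hom(N, M) :=
  [set h | forall b n, h (act b n) = act b (h n)]%classic.
Arguments Hom : clear implicits.

Record modhom (N M : fdmod) := ModHom {
  mhom :> 'Hom(N, M);
  mhomP : Hom N M mhom }.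

Section Kernel.
Variables (N M : fdmod) (g : modhom N M).

Definition ker_act (b : B) (u : subvs_of (lker g)) : subvs_of (lker g) :=
  vsproj (lker g) (act b (vsval u)).

Lemma ker_actE b u : vsval (ker_act b u) = act b (vsval u).
Proof.
rewrite /ker_act vsprojK // memv_ker mhomP.
by have := subvsP u; rewrite memv_ker => /eqP ->; rewrite linear0.
Qed.

Fact ker_actDl a b u : ker_act (a + b) u = ker_act a u + ker_act b u.
Proof. by apply/val_inj; rewrite /= !ker_actE actDl. Qed.
Fact ker_actDr a u v : ker_act a (u + v) = ker_act a u + ker_act a v.
Proof. by apply/val_inj; rewrite /= !ker_actE /= actDr. Qed.
Fact ker_actM a b u : ker_act (a * b) u = ker_act a (ker_act b u).
Proof. by apply/val_inj; rewrite /= !ker_actE actM. Qed.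
Fact ker_act1 u : ker_act 1 u = u.
Proof. by apply/val_inj; rewrite /= !ker_actE act1. Qed.
Fact ker_actZ c u : ker_act (kscal B c) u = c *: u.
Proof. by apply/val_inj; rewrite /= !ker_actE actZ. Qed.

Definition ker_mod : fdmod :=
  FDMod ker_actDl ker_actDr ker_actM ker_act1 ker_actZ.

End Kernel.

(* T (x)_k W for a finite-dimensional k-space W, realized as Hom_k(W^*, T)
   with t (x) w : xi |-> xi(w) t; see tens_univ. *)
Section Tensor.
Variables (T : fdmod) (W : vectType k).

Definition tens_space : vectType k := 'Hom('Hom(W, k^o), T).

Definition pure_fun (t : T) (w : W) (xi : 'Hom(W, k^o)) : T := xi w *: t.
Fact pure_fun_linear t w : linear (pure_fun t w).
Proof.
by move=> c xi eta; rewrite /pure_fun !lfunE /= lfunE /= scalerDl scalerA.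
Qed.
HB.instance Definition _ t w := GRing.isLinear.Build k 'Hom(W, k^o) T *:%R
  (pure_fun t w) (pure_fun_linear t w).

Definition tens_act (b : B) (u : tens_space) : tens_space :=
  (linfun (@act T b) \o u)%VF.

Lemma tens_actE b u xi : tens_act b u xi = act b (u xi).
Proof. by rewrite /tens_act comp_lfunE lfunE. Qed.

Fact tens_actDl a b u : tens_act (a + b) u = tens_act a u + tens_act b u.
Proof. by apply/lfunP => xi; rewrite !(tens_actE, lfunE) /= !tens_actE actDl. Qed.
Fact tens_actDr a u v : tens_act a (u + v) = tens_act a u + tens_act a v.
Proof. by apply/lfunP => xi; rewrite !(tens_actE, lfunE) /= !tens_actE actDr. Qed.
Fact tens_actM a b u : tens_act (a * b) u = tens_act a (tens_act b u).
Proof. by apply/lfunP => xi; rewrite !tens_actE actM. Qed.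
Fact tens_act1 u : tens_act 1 u = u.
Proof. by apply/lfunP => xi; rewrite !tens_actE act1. Qed.
Fact tens_actZ c u : tens_act (kscal B c) u = c *: u.
Proof. by apply/lfunP => xi; rewrite tens_actE lfunE /= actZ. Qed.

Definition tens : fdmod :=
  FDMod tens_actDl tens_actDr tens_actM tens_act1 tens_actZ.

Definition pure (t : T) (w : W) : tens := linfun (pure_fun t w).

Lemma pureE t w xi : (pure t w : 'Hom(_, _)) xi = xi w *: t.
Proof. by rewrite lfunE. Qed.

Lemma pure_act b t w : pure (act b t) w = act b (pure t w).
Proof. by apply/lfunP => xi; rewrite tens_actE !pureE linearZ. Qed.

Lemma pureDl t t' w : pure (t + t') w = pure t w + pure t' w.
Proof. by apply/lfunP => xi; rewrite add_lfunE !pureE scalerDr. Qed.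

Lemma pureDr t w w' : pure t (w + w') = pure t w + pure t w'.
Proof. by apply/lfunP => xi; rewrite add_lfunE !pureE linearD scalerDl. Qed.

Lemma pureZl c t w : pure (c *: t) w = c *: pure t w.
Proof. by apply/lfunP => xi; rewrite scale_lfunE !pureE !scalerA mulrC. Qed.

Lemma pureZr c t w : pure t (c *: w) = c *: pure t w.
Proof. by apply/lfunP => xi; rewrite scale_lfunE !pureE linearZ scalerA. Qed.

End Tensor.

Section Ext.
Variables (N M : fdmod).

(* The free presentation 0 -> syzygy -> B^n -> N -> 0 given by a k-basis
   of N. *)
Definition pres (x : 'rV[B]_(\dim {:N})) : N :=
  \sum_i act (x 0 i) (vbasis {:N})`_i.

Fact presD x y : pres (x + y) = pres x + pres y.
Proof. by rewrite -big_split; apply: eq_bigr => i _; rewrite mxE actDl. Qed.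
Fact presZ b x : pres (b *: x) = act b (pres x).
Proof.
rewrite /pres linear_sum; apply: eq_bigr => i _; by rewrite mxE actM.
Qed.

Definition syzygy_pred : {pred 'rV[B]_(\dim {:N})} := [pred x | pres x == 0].
Fact syzygy_submod : submod_closed syzygy_pred.
Proof.
split=> [|b x y]; rewrite !inE.
  by apply/eqP; rewrite -(scale0r 0) presZ act0l.
by move=> /eqP x0 /eqP y0; rewrite presD presZ x0 y0 addr0 linear0.
Qed.
HB.instance Definition _ := GRing.isSubmodClosed.Build B _ syzygy_pred
  syzygy_submod.

Record syzygy := Syzygy {
  syz_val :> 'rV[B]_(\dim {:N});
  syz_valP : syz_val \in syzygy_pred }.
HB.instance Definition _ := [isSub for syz_val].
HB.instance Definition _ := [Choice of syzygy by <:].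
HB.instance Definition _ := [SubChoice_isSubLmodule of syzygy by <:].

Definition is_lin (X : lmodType B) (h : X -> M) : Prop :=
  forall b x y, h (b *: x + y) = act b (h x) + h y.

(* Ext^1_B(N, M) is the cokernel of Hom_B(B^n, M) -> Hom_B(syzygy, M). *)
Definition syz_hom : set (syzygy -> M) := [set h | is_lin h]%classic.
Definition syz_ext : set (syzygy -> M) :=
  [set h | exists h' : 'rV[B]_(\dim {:N}) -> M,
    is_lin h' /\ forall x : syzygy, h x = h' (syz_val x)]%classic.

Definition finite_Ext1 : Prop := finite_qdim syz_hom syz_ext.
Definition dimExt1 : nat := qdim syz_hom syz_ext.

End Ext.

Definition euler (N M : fdmod) : int :=
  (dimk (Hom N M))%:Z - (dimExt1 N M)%:Z.

Definition kspan (I : finType) (s : I -> B) : set B :=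
  [set b | exists c : I -> k, b = \sum_i kscal B (c i) * s i]%classic.

Definition Der (S : set B) (N M : fdmod) : set (B -> 'Hom(N, M)) :=
  [set d | [/\ forall a b, d (a + b) = d a + d b,
      forall c b, d (kscal B c * b) = c *: d b,
      forall a b n, d (a * b) n = act a (d b n) + d a (act b n) &
      forall s, S s -> d s = 0]]%classic.

End FiniteDimensionalModules.
Arguments Hom {k B} N M _.
Arguments Der {k B} S N M _.

Lemma tens_univ (k : fieldType) (B : kalgebra k) (T : fdmod B) (W X : vectType k)
    (h : T -> W -> X) :
  (forall t, linear (h t)) -> (forall w, linear (h^~ w)) ->
  exists! F : 'Hom(tens T W, X), forall t w, F (pure t w) = h t w.
Proof.
move=> lr ll.
pose xi (j : 'I_(\dim {:W})) : 'Hom(W, k^o) := linfun (coord (vbasis {:W}) j : W -> k^o).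
have xiE j w : xi j w = coord (vbasis {:W}) j w.
  pose c : {linear W -> k^o} := HB.pack (coord (vbasis {:W}) j : W -> k^o)
    (GRing.isLinear.Build k W k^o *:%R (coord (vbasis {:W}) j : W -> k^o)
      (fun a u v => linearP (coord (vbasis {:W}) j) a u v)).
  by rewrite /xi -[LHS]/(linfun c w) lfunE.
have dec (u : tens T W) :
    u = \sum_j pure ((u : 'Hom(_, _)) (xi j)) (vbasis {:W})`_j.
  apply/lfunP => eta; rewrite sum_lfunE.
  have -> : eta = \sum_(j < \dim {:W}) eta (vbasis {:W})`_j *: xi j.
    apply/lfunP => w; rewrite sum_lfunE {1}(coord_vbasis (memvf w)) linear_sum.
    apply: eq_bigr => j _; rewrite linearZ scale_lfunE xiE.
    by rewrite [RHS]mulrC.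
  rewrite linear_sum; apply: eq_bigr => j _.
  rewrite linearZ pureE; congr (_ *: _).
  rewrite sum_lfunE (bigD1 j) //= big1 ?addr0 => [|l lj];
    rewrite scale_lfunE xiE coord_free ?(basis_free (vbasisP _)) //.
    by rewrite eqxx [RHS]mulr1.
  by rewrite eq_sym (negPf lj) [LHS]mulr0.
pose F0 (u : tens T W) :=
  \sum_j h ((u : 'Hom(_, _)) (xi j)) (vbasis {:W})`_j.
have F0L : linear F0.
  move=> c u v; rewrite /F0 scaler_sumr -big_split; apply: eq_bigr => j _ /=.
  by rewrite add_lfunE scale_lfunE ll.
pose F1 : {linear tens T W -> X} :=
  HB.pack F0 (GRing.isLinear.Build k (tens T W) X *:%R F0 F0L).
have hZl c t w : h (c *: t) w = c *: h t w.
  by have := ll w c t 0; rewrite addr0 => ->;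
     have := ll w (-1) 0 0; rewrite scaler0 addr0 scaleN1r addNr => ->;
     rewrite addr0.
have hsum t (c : 'I_(\dim {:W}) -> k) (y : 'I_(\dim {:W}) -> W) :
    h t (\sum_j c j *: y j) = \sum_j c j *: h t (y j).
  pose H : {linear W -> X} :=
    HB.pack (h t) (GRing.isLinear.Build k W X *:%R (h t) (lr t)).
  rewrite -[h t]/(H : W -> X) linear_sum.
  by apply: eq_bigr => j _; rewrite linearZ.
exists (linfun F1); split=> [t w|F HF].
  rewrite lfunE /= /F0 {2}(coord_vbasis (memvf w)) hsum.
  by apply: eq_bigr => j _; rewrite pureE xiE hZl.
apply/lfunP => u; rewrite lfunE /= /F0 [in RHS](dec u) linear_sum.
by apply: eq_bigr => j _; exact: (esym (HF _ _)).
Qed.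

Record quiver := Quiver {
  vertex : finType;
  arrow : finType;
  src : arrow -> vertex;
  tgt : arrow -> vertex }.

Section PathAlgebra.
Variables (k : fieldType) (Q : quiver).

(* A path is a starting vertex with the arrows listed in the order in which
   they are traversed. *)
Fixpoint walk (i : vertex Q) (s : seq (arrow Q)) : bool :=
  if s is a :: s' then (src a == i) && walk (tgt a) s' else true.

Definition walk_end (i : vertex Q) (s : seq (arrow Q)) : vertex Q :=
  last i (map (@tgt Q) s).

Record qpath := QPath {
  path_val :> vertex Q * seq (arrow Q);
  path_valP : walk path_val.1 path_val.2 }.
HB.instance Definition _ := [isSub for path_val].
HB.instance Definition _ := [Choice of qpath by <:].

Definition path_start (p : qpath) : vertex Q := (val p).1.
Definition path_end (p : qpath) : vertex Q := walk_end (val p).1 (val p).2.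

Definition trivial_path (i : vertex Q) : qpath :=
  @QPath (i, [::]) isT.

Lemma walk_cat i s s' : walk i (s ++ s') = walk i s && walk (walk_end i s) s'.
Proof. by elim: s i => //= a s IH i; rewrite IH andbA. Qed.

(* pq is q followed by p, so that left kQ-modules are representations of Q. *)
Definition pcomp (p q : qpath) : option qpath :=
  if path_end q == path_start p
  then insub ((val q).1, (val q).2 ++ (val p).2) else None.

Lemma pcompP p q r : pcomp p q = Some r <->
  path_end q = path_start p /\ val r = ((val q).1, (val q).2 ++ (val p).2).
Proof.
rewrite /pcomp; case: eqP => [e|ne]; last by split=> // -[].
have w : walk (val q).1 ((val q).2 ++ (val p).2).
  rewrite walk_cat (valP q) /= -/(path_end q) e; exact: (valP p).
split=> [|[_ rE]]; last by rewrite -rE valK.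
by case: insubP => //= r' _ r'E [<-].
Qed.

Lemma pcomp_start p q r : pcomp p q = Some r -> path_start r = path_start q.
Proof. by move=> /pcompP [_ E]; rewrite /path_start E. Qed.

Lemma pcomp_end p q r : pcomp p q = Some r -> path_end r = path_end p.
Proof.
move=> /pcompP [e E]; rewrite /path_end E /= /walk_end map_cat last_cat.
by move: e; rewrite /path_end /path_start /walk_end => ->.
Qed.

Lemma pcompN p q : path_end q != path_start p -> pcomp p q = None.
Proof. by rewrite /pcomp => /negPf ->. Qed.

Lemma pcompT p q : path_end q = path_start p -> exists r, pcomp p q = Some r.
Proof.
move=> e; rewrite /pcomp e eqxx.
case: insubP => [r _ _|/negP []]; first by exists r.
rewrite walk_cat (valP q) /= -/(path_end q) e; exact: (valP p).
Qed.

Lemma pcompA p q r :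
  obind (pcomp p) (pcomp q r) = obind (pcomp^~ r) (pcomp p q).
Proof.
case: (eqVneq (path_end r) (path_start q)) => [e1|n1]; last first.
  rewrite (pcompN n1) /=; case E: (pcomp p q) => [s|] //=.
  by rewrite pcompN // (pcomp_start E).
have [qr Eqr] := pcompT e1; rewrite Eqr /=.
case: (eqVneq (path_end q) (path_start p)) => [e2|n2]; last first.
  by rewrite (pcompN n2) /= pcompN // (pcomp_end Eqr).
have [pq Epq] := pcompT e2; rewrite Epq /=.
have [s Es] : exists s, pcomp p qr = Some s.
  by apply: pcompT; rewrite (pcomp_end Eqr).
rewrite Es; apply/esym/pcompP; rewrite (pcomp_start Epq); split=> //.
move/pcompP: Es => [_ ->]; move/pcompP: Epq => [_ ->].
by move/pcompP: Eqr => [_ ->] /=; rewrite catA.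
Qed.

Lemma pcomp_triv_l i p :
  pcomp (trivial_path i) p = if path_end p == i then Some p else None.
Proof.
case: eqP => [e|/eqP n]; last by rewrite pcompN.
by apply/pcompP; split=> //=; rewrite cats0; case: (val p).
Qed.

Lemma pcomp_triv_r i p :
  pcomp p (trivial_path i) = if path_start p == i then Some p else None.
Proof.
case: eqP => [e|/eqP n]; last by rewrite pcompN // eq_sym.
apply/pcompP; split=> //=.
by rewrite -e /path_start; case: p {e} => [[]].
Qed.

Definition path_space : Type := {malg k[qpath]}.
HB.instance Definition _ := GRing.Lmodule.on path_space.

Definition basis_mul (p q : qpath) : path_space :=
  if pcomp p q is Some r then << r >> else 0.

Definition path_mul (x y : path_space) : path_space :=
  \sum_(p <- msupp x) \sum_(q <- msupp y) (x@_p * y@_q) *: basis_mul p q.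

Definition path_one : path_space := \sum_(i : vertex Q) << trivial_path i >>.

Let path_mulw (d1 d2 : {fset qpath}) (x y : path_space) :
  (msupp x `<=` d1)%fset -> (msupp y `<=` d2)%fset ->
  path_mul x y =
    \sum_(p <- d1) \sum_(q <- d2) (x@_p * y@_q) *: basis_mul p q.
Proof.
move=> s1 s2; rewrite /path_mul (big_fset_incl _ s1) /=.
  apply: eq_bigr => p _; apply: big_fset_incl => // q _ /mcoeff_outdom ->.
  by rewrite mulr0 scale0r.
move=> p _ /mcoeff_outdom x0.
by rewrite big1 // => q _; rewrite x0 mul0r scale0r.
Qed.

Fact path_mulDl : left_distributive path_mul +%R.
Proof.
move=> x y z.
rewrite (path_mulw (msuppD_le x y) (fsubset_refl _)).
rewrite (path_mulw (fsubsetUl _ (msupp y)) (fsubset_refl (msupp z))).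
rewrite (path_mulw (fsubsetUr (msupp x) _) (fsubset_refl (msupp z))).
rewrite -big_split; apply: eq_bigr => p _ /=.
rewrite -big_split; apply: eq_bigr => q _ /=.
by rewrite mcoeffD mulrDl scalerDl.
Qed.

Fact path_mulDr : right_distributive path_mul +%R.
Proof.
move=> z x y.
rewrite (path_mulw (fsubset_refl _) (msuppD_le x y)).
rewrite (path_mulw (fsubset_refl (msupp z)) (fsubsetUl _ (msupp y))).
rewrite (path_mulw (fsubset_refl (msupp z)) (fsubsetUr (msupp x) _)).
rewrite -big_split; apply: eq_bigr => p _ /=.
rewrite -big_split; apply: eq_bigr => q _ /=.
by rewrite mcoeffD mulrDr scalerDl.
Qed.

Let path_mul0l x : path_mul 0 x = 0.
Proof. by rewrite /path_mul msupp0 big_seq_fset0. Qed.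

Let path_mul0r x : path_mul x 0 = 0.
Proof. by rewrite /path_mul msupp0 big1 // => p _; rewrite big_seq_fset0. Qed.

Lemma path_mulUU c d p q :
  path_mul << c *g p >> << d *g q >> = (c * d) *: basis_mul p q.
Proof.
by rewrite (path_mulw msuppU_le msuppU_le) !big_seq_fset1 !mcoeffUU.
Qed.

Let UE (c : k) (p : qpath) : << c *g p >> = c *: (<< p >> : path_space).
Proof. by apply/malgP => r; rewrite mcoeffZ !mcoeffU mulrnAr mulr1. Qed.

Let path_mulZl c x y : path_mul (c *: x) y = c *: path_mul x y.
Proof.
rewrite (path_mulw (msuppZ_le c x) (fsubset_refl _)) /path_mul scaler_sumr.
apply: eq_bigr => p _; rewrite scaler_sumr; apply: eq_bigr => q _.
by rewrite mcoeffZ scalerA mulrA.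
Qed.

Let path_mulZr c x y : path_mul x (c *: y) = c *: path_mul x y.
Proof.
rewrite (path_mulw (fsubset_refl _) (msuppZ_le c y)) /path_mul scaler_sumr.
apply: eq_bigr => p _; rewrite scaler_sumr; apply: eq_bigr => q _.
by rewrite mcoeffZ scalerA mulrCA.
Qed.

Let path_muls1 (I : Type) (r : seq I) (F : I -> path_space) y :
  path_mul (\sum_(i <- r) F i) y = \sum_(i <- r) path_mul (F i) y.
Proof.
exact: (big_morph (path_mul^~ y) (fun a b => path_mulDl a b y) (path_mul0l y)).
Qed.

Let path_muls2 (I : Type) (r : seq I) (F : I -> path_space) y :
  path_mul y (\sum_(i <- r) F i) = \sum_(i <- r) path_mul y (F i).
Proof. exact: (big_morph (path_mul y) (path_mulDr y) (path_mul0r y)). Qed.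

Local Opaque path_mul.

Let path_add2 (x x' y y' : path_space) : x = x' -> y = y' -> x + y = x' + y'.
Proof. by move=> -> ->. Qed.

Let path_mulZ3l a b c u v w :
  path_mul (a *: u) (path_mul (b *: v) (c *: w))
  = a *: (b *: (c *: path_mul u (path_mul v w))).
Proof. by rewrite path_mulZl path_mulZl path_mulZr path_mulZr path_mulZr. Qed.

Let path_mulZ3r a b c u v w :
  path_mul (path_mul (a *: u) (b *: v)) (c *: w)
  = a *: (b *: (c *: path_mul (path_mul u v) w)).
Proof.
rewrite path_mulZl path_mulZl.
rewrite [path_mul u (b *: v)]path_mulZr path_mulZl.
by rewrite path_mulZr.
Qed.

Fact path_mulA : associative path_mul.
Proof.
move=> x y z; rewrite [x]monalgE.
elim/big_rec: _ => [|p x' _ IH]; first by rewrite !path_mul0l.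
rewrite !path_mulDl; apply: path_add2 IH; move: (x@_p) => a {x x'}.
rewrite [y]monalgE; elim/big_rec: _ => [|q y' _ IH].
  by rewrite path_mul0l path_mul0r path_mul0l.
rewrite path_mulDl !path_mulDr path_mulDl; apply: path_add2 IH.
move: (y@_q) => b {y y'}.
rewrite [z]monalgE; elim/big_rec: _ => [|r z' _ IH].
  by rewrite !path_mul0r.
rewrite !path_mulDr; apply: path_add2 IH; move: (z@_r) => c {z z'}.
rewrite (UE a) (UE b) (UE c) path_mulZ3l path_mulZ3r.
apply: (congr1 (fun u : path_space => a *: (b *: (c *: u)))).
have U1 u v : path_mul << u >> << v >> = basis_mul u v.
  by rewrite path_mulUU mulr1 scale1r.
rewrite !U1; have := pcompA p q r; rewrite /basis_mul.
case: (pcomp q r) => [s|]; case: (pcomp p q) => [t|] /=;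
  rewrite ?path_mul0l ?path_mul0r ?U1 /basis_mul //.
- by move=> ->.
- by move=> ->.
- by move=> <-.
Qed.

Fact path_mul1l : left_id path_one path_mul.
Proof.
move=> x; rewrite {1}[x]monalgE [RHS]monalgE path_muls2.
apply: eq_bigr => p _; rewrite path_muls1 (bigD1 (path_end p)) //= big1.
  by rewrite path_mulUU /basis_mul pcomp_triv_l eqxx addr0 mul1r -UE.
move=> i ni; rewrite path_mulUU /basis_mul pcomp_triv_l eq_sym (negPf ni).
by rewrite scaler0.
Qed.

Fact path_mul1r : right_id path_one path_mul.
Proof.
move=> x; rewrite {1}[x]monalgE [RHS]monalgE path_muls1.
apply: eq_bigr => p _; rewrite path_muls2 (bigD1 (path_start p)) //= big1.
  by rewrite path_mulUU /basis_mul pcomp_triv_r eqxx addr0 mulr1 -UE.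
move=> i ni; rewrite path_mulUU /basis_mul pcomp_triv_r eq_sym (negPf ni).
by rewrite scaler0.
Qed.

HB.instance Definition _ := GRing.Zmodule_isPzRing.Build path_space
  path_mulA path_mul1l path_mul1r path_mulDl path_mulDr.

Definition path_scal (c : k) : path_space := c *: path_one.
Fact path_scal_zmod : zmod_morphism path_scal.
Proof. by move=> c d; rewrite /path_scal scalerBl. Qed.
Fact path_scal_monoid : monoid_morphism path_scal.
Proof.
split=> [|c d]; first by rewrite /path_scal scale1r.
rewrite /path_scal -[RHS]/(path_mul _ _) path_mulZl path_mulZr path_mul1l.
by rewrite scalerA.
Qed.
HB.instance Definition _ :=
  GRing.isZmodMorphism.Build k path_space path_scal path_scal_zmod.
HB.instance Definition _ :=
  GRing.isMonoidMorphism.Build k path_space path_scal path_scal_monoid.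

Fact path_scalC (c : k) (x : path_space) : path_scal c * x = x * path_scal c.
Proof.
rewrite -[LHS]/(path_mul _ _) -[RHS]/(path_mul _ _) /path_scal.
by rewrite path_mulZl path_mulZr path_mul1l path_mul1r.
Qed.

Definition path_algebra : kalgebra k :=
  @KAlgebra k path_space path_scal path_scalC.

Definition vertex_idem (i : vertex Q) : path_algebra :=
  (<< trivial_path i >> : path_space).

End PathAlgebra.
Arguments vertex_idem k {Q} i.

Section OnePointExtension.
Variables (k : fieldType) (A : kalgebra k) (T : fdmod A).

(* (a, t, l) stands for the formal matrix with rows (a, t) and (0, l). *)
Definition op_space : Type := (A * T * k)%type.
HB.instance Definition _ := GRing.Zmodule.on op_space.

Definition op_mul (x y : op_space) : op_space :=
  (x.1.1 * y.1.1, act x.1.1 y.1.2 + y.2 *: x.1.2, x.2 * y.2).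
Definition op_one : op_space := (1, 0, 1).

Fact op_mulA : associative op_mul.
Proof.
move=> [[a t] l] [[b u] m] [[c v] n]; rewrite /op_mul /= !mulrA.
by rewrite actDr actM linearZ scalerDr scalerA [n * m]mulrC addrA.
Qed.
Fact op_mul1l : left_id op_one op_mul.
Proof.
by move=> [[a t] l]; rewrite /op_mul /= !mul1r act1 scaler0 addr0.
Qed.
Fact op_mul1r : right_id op_one op_mul.
Proof.
by move=> [[a t] l]; rewrite /op_mul /= !mulr1 linear0 scale1r add0r.
Qed.
Fact op_mulDl : left_distributive op_mul +%R.
Proof.
move=> [[a t] l] [[b u] m] [[c v] n]; rewrite /op_mul /=.
by congr (_, _, _); rewrite ?mulrDl // actDl scalerDr addrACA.
Qed.
Fact op_mulDr : right_distributive op_mul +%R.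
Proof.
move=> [[a t] l] [[b u] m] [[c v] n]; rewrite /op_mul /=.
by congr (_, _, _); rewrite ?mulrDr // actDr scalerDl addrACA.
Qed.
HB.instance Definition _ := GRing.Zmodule_isPzRing.Build op_space
  op_mulA op_mul1l op_mul1r op_mulDl op_mulDr.

Definition op_scal (c : k) : op_space := (kscal A c, 0, c).
Fact op_scal_zmod : zmod_morphism op_scal.
Proof.
move=> c d; rewrite /op_scal rmorphB /=.
by congr (_, _, _); rewrite subr0.
Qed.
Fact op_scal_monoid : monoid_morphism op_scal.
Proof.
split=> [|c d]; first by rewrite /op_scal rmorph1.
rewrite /op_scal rmorphM -[RHS]/(op_mul _ _) /op_mul /=.
by rewrite linear0 scaler0 addr0.
Qed.
HB.instance Definition _ :=
  GRing.isZmodMorphism.Build k op_space op_scal op_scal_zmod.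
HB.instance Definition _ :=
  GRing.isMonoidMorphism.Build k op_space op_scal op_scal_monoid.

Fact op_scalC (c : k) (x : op_space) : op_scal c * x = x * op_scal c.
Proof.
case: x => [[a t] l]; rewrite -[LHS]/(op_mul _ _) -[RHS]/(op_mul _ _).
rewrite /op_mul /= kscalC actZ scaler0 addr0 linear0 add0r.
by rewrite mulrC.
Qed.

Definition one_point_ext : kalgebra k := @KAlgebra k op_space op_scal op_scalC.

(* The A[T]-module M + V of a triple (M, V, f). *)
Section Triple.
Variables (M : fdmod A) (V : vectType k) (f : modhom (tens T V) M).

Definition triple_act (x : one_point_ext) (m : (M * V)%type) : (M * V)%type :=
  let: (a, t, l) := (x : op_space) in (act a m.1 + f (pure t m.2), l *: m.2).

Fact triple_actDl x y m :
  triple_act (x + y) m = triple_act x m + triple_act y m.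
Proof.
case: x y m => [[a t] l] [[b u] n] [m v] /=.
by congr (_, _); rewrite /= ?scalerDl // actDl pureDl linearD addrACA.
Qed.
Fact triple_actDr x m n :
  triple_act x (m + n) = triple_act x m + triple_act x n.
Proof.
case: x m n => [[a t] l] [m v] [n w] /=.
by congr (_, _); rewrite /= ?scalerDr // actDr pureDr linearD addrACA.
Qed.
Fact triple_actM x y m :
  triple_act (x * y) m = triple_act x (triple_act y m).
Proof.
case: x y m => [[a t] l] [[b u] n] [m v] /=.
congr (_, _); last by rewrite scalerA.
have E : f (pure (act a u + n *: t) v)
    = act a (f (pure u v)) + f (pure t (n *: v)).
  rewrite pureDl linearD pure_act pureZl pureZr; congr (_ + _).
  exact: mhomP.
by rewrite E actM actDr addrA.
Qed.
Fact triple_act1 m : triple_act 1 m = m.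
Proof.
case: m => [m v] /=; rewrite act1 scale1r.
by rewrite -(scale0r 0) pureZl scale0r linear0 addr0.
Qed.
Fact triple_actZ c m : triple_act (kscal one_point_ext c) m = c *: m.
Proof.
case: m => [m v] /=; rewrite actZ.
by rewrite -(scale0r 0) pureZl scale0r linear0 addr0.
Qed.

Definition triple_mod : fdmod one_point_ext :=
  FDMod triple_actDl triple_actDr triple_actM triple_act1 triple_actZ.

End Triple.

End OnePointExtension.

Section Idempotents.
Variables (k : fieldType) (Q : quiver).

Definition vertex_subalg : set (path_algebra k Q) := kspan (vertex_idem k).

Variable T : fdmod (path_algebra k Q).

(* None indexes the idempotent with entry 1 in the lower right corner. *)
Definition op_idem (o : option (vertex Q)) : one_point_ext T :=
  if o is Some i then ((vertex_idem k i, 0, 0) : op_space T)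
  else ((0, 0, 1) : op_space T).

Definition op_subalg : set (one_point_ext T) := kspan op_idem.

End Idempotents.
Arguments vertex_subalg k Q _ : clear implicits.
Arguments op_subalg {k Q} T _.

(* Main.v *)
Require Import Defs.
From HB Require Import structures.
From mathcomp Require Import all_boot all_order all_algebra.
From mathcomp Require Import boolp classical_sets functions.
From mathcomp Require Import finmap monalg.
Local Open Scope ring_scope.

(** Write U for the tensor product of T and W, and e, eps for the idempotents
    of A[T] in the upper left and lower right corners. A derivation of A[T]
    vanishing on the vertices and on eps kills the corner of eps, and by the
    Peirce decomposition it is a pair (d, h): a derivation d of A with values
    in Hom(N, M) that vanishes on the vertices, and a linear map h from U to M.
    The Leibniz rule for the products a t couples them by
      h (a z) = a h(z) + d(a) (g z),
    that is, the derivation g^* d with values in Hom(U, M) is minus the inner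
    derivation of h ([op_der_Der], [op_der_components], [compatibleP]).

    For a path algebra such data are finite. A derivation vanishing on the
    vertices is given by arbitrary blocks on the arrows
    u_a : e_(src a) X -> e_(tgt a) M ([der_of_Der], [der_dataK]), and a linear
    map commuting with the vertices is given by blocks h_i : e_i X -> e_i M.
    Inner derivations define a coboundary from the space C0(X) of vertex blocks
    to the space C1(X) of arrow blocks. Its kernel is Hom(X, M), and its cokernel
    is Ext^1(X, M): an extension of X by M is a derivation, and pushing the free
    presentation of X through that extension gives the corresponding map on the
    syzygy ([is_qdim_Hom], [is_qdim_Ext1]). In particular the Euler form is
    <X, M> = dim C0(X) - dim C1(X) ([eulerE]).

    The derivations of A[T] are thus the kernel of the map from C1(N) x C0(U)
    to C1(U) that sends (u, h) to g^* u + cobd h, and rank-nullity reduces the theorem to its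
    cokernel. Blocks extend along injections and factor through g as soon as
    they vanish on ker g ([pull_factor]); so restriction from U to ker g is onto
    on blocks, the arrow blocks of U that it kills are those in g^* C1(N), and
    the cokernel is Ext^1(ker g, M) ([dim_coker_pull]). Finally the blocks of U
    are dim W copies of those of T ([dim_blocks_tens]), which makes
    dim C0(U) - dim C1(U) equal to dim W * <T, M>. *)

Set Implicit Arguments.
Unset Strict Implicit.
Unset Printing Implicit Defensive.
Import GRing.Theory.

(** * Linear algebra *)

Section LinearAlgebra.
Variable k : fieldType.
Implicit Types E F : vectType k.

Definition lfun_of E F (h : E -> F) (hL : linear h) : 'Hom(E, F) :=
  linfun (HB.pack_for {linear E -> F} h
    (GRing.isLinear.Build k E F *:%R h hL)).

Lemma lfun_ofE E F (h : E -> F) (hL : linear h) : lfun_of hL =1 h.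
Proof. by move=> x; rewrite lfunE. Qed.

(** Derivations and maps out of a syzygy live in infinite-dimensional spaces,
    where subspaces have no [\dim]. This lemma computes U/V in a
    finite-dimensional space that parametrizes U up to V. *)
Lemma is_qdim_image E (X : lmodType k) (U V : set X) (h : E -> X)
    (S K : {vspace E}) :
  linear h -> is_subspace V -> (K <= S)%VS ->
  (forall s, s \in S -> U (h s)) ->
  (forall u, U u -> exists2 s, s \in S & V (u - h s)) ->
  (forall s, s \in S -> V (h s) <-> s \in K) ->
  is_qdim U V (\dim S - \dim K)%N.
Proof.
move=> hL [V0 VL] KS hU hS hK.
pose hl : {linear E -> X} :=
  HB.pack_for {linear E -> X} h (GRing.isLinear.Build k E X *:%R h hL).
have hsum n (c : 'rV_n) (x : 'I_n -> E) :
    h (\sum_i c 0 i *: x i) = \sum_i c 0 i *: h (x i).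
  rewrite -[h]/(hl : E -> X) linear_sum; apply: eq_bigr => i _.
  by rewrite linearZ.
have VD u v : V u -> V v -> V (u + v).
  by move=> Vu Vv; rewrite -[u]scale1r; apply: VL.
have VN u : V u -> V (- u).
  by move=> Vu; rewrite -[- u]addr0 -scaleN1r; apply: VL.
pose C := (S :\: K)%VS.
have CS : (C <= S)%VS by exact: diffvSl.
have <- : \dim C = (\dim S - \dim K)%N.
  by rewrite -(dimv_cap_compl S K) (capv_idPr KS) addKn.
exists (fun i => h (vbasis C)`_i); split=> [i|u Uu].
  apply/hU/(subvP CS)/vbasis_mem/mem_nth; by rewrite size_tuple.
have [s sS Vs] := hS _ Uu.
have : s \in (C + S :&: K)%VS by rewrite addv_diff_cap.
case/memv_addP=> c cC [z /memv_capP[zS zK] sE].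
pose cc : 'rV_(\dim C) := \row_i coord (vbasis C) i c.
have ccE : \sum_i cc 0 i *: (vbasis C)`_i = c.
  by rewrite [RHS](coord_vbasis cC); apply: eq_bigr => i _; rewrite mxE.
have Vc : V (u - h c).
  have -> : u - h c = (u - h s) + h z.
    rewrite sE -[h (c + z)]/(hl (c + z)) linearD /= opprD addrA.
    by rewrite -[_ - _ + _]addrA addNr addr0.
  by apply: VD => //; apply/hK.
exists cc; split; first by rewrite -hsum ccE.
move=> c' Vc'; apply/rowP => i; apply/eqP; rewrite -subr_eq0; apply/eqP.
pose y := \sum_i (cc 0 i - c' 0 i) *: (vbasis C)`_i.
have yC : y \in C.
  apply: memv_suml => j _; apply/memvZ/vbasis_mem/mem_nth.
  by rewrite size_tuple.
have yK : y \in K.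
  apply/hK; first exact: (subvP CS).
  have -> : h y = (u - \sum_i c' 0 i *: h (vbasis C)`_i) - (u - h c).
    have -> : y = c - \sum_i c' 0 i *: (vbasis C)`_i.
      rewrite -ccE -sumrB; apply: eq_bigr => j _; exact: scalerBl.
    rewrite -[h (_ - _)]/(hl (_ - _)) linearB /= hsum opprB [RHS]addrC.
    by rewrite addrA subrK.
  by apply: VD => //; apply: VN.
have y0 : y = 0.
  by apply/eqP; rewrite -memv0 -(capv_diff S K) memv_cap yC.
by have /freeP/(_ _ y0 i) := basis_free (vbasisP C).
Qed.

Lemma is_subspace0 (X : lmodType k) : is_subspace ([set 0]%classic : set X).
Proof. by split=> // c u v -> ->; rewrite scaler0 addr0. Qed.

Lemma is_qdim_isom E (X : lmodType k) (U : set X) (h : E -> X)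
    (S : {vspace E}) :
  linear h ->
  (forall s, s \in S -> U (h s)) ->
  (forall u, U u -> exists2 s, s \in S & u = h s) ->
  (forall s, s \in S -> h s = 0 -> s = 0) ->
  is_qdim U [set 0]%classic (\dim S).
Proof.
move=> hL hU hS hI.
have h0 : h 0 = 0 by have := hL (-1) 0 0; rewrite scaler0 addr0 scaleN1r addNr.
have -> : \dim S = (\dim S - \dim (0%VS : {vspace E}))%N by rewrite dimv0 subn0.
apply: is_qdim_image hL _ (sub0v _) hU _ _.
- exact: is_subspace0.
- by move=> u /hS[s sS ->]; exists s => //; rewrite subrr.
- move=> s sS; rewrite memv0; split=> [hs0|/eqP ->]; last exact: h0.
  by rewrite (hI s sS hs0).
Qed.

(** The orthogonal idempotents [i_ j \o p_ j] split E' into copies of E,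
    compatibly with the two subspaces. *)
Lemma dimv_copies E E' (J : finType) (S : {vspace E}) (S' : {vspace E'})
    (i_ : J -> 'Hom(E, E')) (p_ : J -> 'Hom(E', E)) :
  (forall j x, p_ j (i_ j x) = x) ->
  (forall j l x, j != l -> p_ j (i_ l x) = 0) ->
  (forall y, \sum_j i_ j (p_ j y) = y) ->
  (forall j x, x \in S -> i_ j x \in S') ->
  (forall j y, y \in S' -> p_ j y \in S) ->
  \dim S' = (#|J| * \dim S)%N.
Proof.
move=> pi_id pi0 ip_id iS pS.
have -> : S' = (\sum_j i_ j @: S)%VS.
  apply/eqP; rewrite eqEsubv; apply/andP; split.
    apply/subvP => y yS; rewrite -(ip_id y); apply: memv_sumr => j _.
    exact/memv_img/pS.
  apply/subv_sumP => j _; apply/subvP => _ /memv_imgP[x xS ->]; exact: iS.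
have dj j : \dim (i_ j @: S) = \dim S.
  apply/limg_dim_eq/eqP; rewrite -subv0; apply/subvP => x /memv_capP[_].
  by rewrite memv_ker memv0 => /eqP ix0; rewrite -(pi_id j x) ix0 linear0.
have /directvP -> : directv (\sum_j i_ j @: S)%VS.
  apply/directv_sum_independent => u uS su0 j _.
  have {}uS l : exists x, u l = i_ l x.
    by have /memv_imgP[x _ ->] := uS l isT; exists x.
  have : p_ j (\sum_l u l) = 0 by rewrite su0 linear0.
  rewrite linear_sum (bigD1 j) //= big1 ?addr0 => [|l lj].
    by have [x ->] := uS j; rewrite pi_id => ->; rewrite linear0.
  by have [x ->] := uS l; rewrite pi0 // eq_sym.
rewrite /= (eq_bigr (fun=> \dim S)) //; by rewrite sum_nat_const.
Qed.

(** Rank-nullity for the map (x, y) |-> a x + b y on S1 x S2. *)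
Lemma dim_fibre_product E1 E2 F (a : 'Hom(E1, F)) (b : 'Hom(E2, F))
    (S1 : {vspace E1}) (S2 : {vspace E2}) :
  exists P : {vspace (E1 * E2)%type},
    (forall x, (x \in P) = [&& x.1 \in S1, x.2 \in S2 & a x.1 + b x.2 == 0]) /\
    (\dim P + \dim (a @: S1 + b @: S2) = \dim S1 + \dim S2)%N.
Proof.
have i1L : linear (fun x : E1 => (x, 0 : E2)).
  by move=> c x y; congr (_, _); rewrite /= scaler0 addr0.
have i2L : linear (fun y : E2 => (0 : E1, y)).
  by move=> c x y; congr (_, _); rewrite /= scaler0 addr0.
have cL : linear (fun x : E1 * E2 => a x.1 + b x.2).
  move=> c x y /=; rewrite !linearP /= scalerDr.
  by rewrite -!addrA; congr (_ + _); rewrite addrCA.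
pose i1 := lfun_of i1L; pose i2 := lfun_of i2L; pose h := lfun_of cL.
pose S := (i1 @: S1 + i2 @: S2)%VS.
have memS x : (x \in S) = (x.1 \in S1) && (x.2 \in S2).
  apply/idP/andP=> [|[x1 x2]].
    case/memv_addP => _ /memv_imgP[u uS ->] [_ /memv_imgP[v vS ->] ->].
    by rewrite !lfun_ofE /= addr0 add0r.
  have -> : x = i1 x.1 + i2 x.2.
    by rewrite !lfun_ofE; case: x {x1 x2} => u v; congr (_, _);
       rewrite /= ?addr0 ?add0r.
  by rewrite memv_add // memv_img.
have dS : \dim S = (\dim S1 + \dim S2)%N.
  rewrite /S dimv_disjoint_sum.
    congr (_ + _)%N; apply/limg_dim_eq/eqP; rewrite -subv0; apply/subvP => x;
    by case/memv_capP=> _; rewrite memv_ker lfun_ofE memv0 xpair_eqE => /andP[].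
  apply/eqP; rewrite -subv0; apply/subvP => z /memv_capP[].
  case/memv_imgP=> u _ ->; case/memv_imgP=> v _; rewrite !lfun_ofE memv0.
  by case=> -> _.
exists (S :&: lker h)%VS; split.
  by move=> x; rewrite memv_cap memS memv_ker lfun_ofE andbA.
rewrite -dS -(limg_ker_dim h S); congr (_ + \dim _)%N.
rewrite /S limgD -!limg_comp; congr (_ + _)%VS.
  by apply: eq_in_limg => x _; rewrite comp_lfunE !lfun_ofE /= linear0 addr0.
by apply: eq_in_limg => x _; rewrite comp_lfunE !lfun_ofE /= linear0 add0r.
Qed.

(** The codimensions of G in S and of i @: G in i @: S agree because G contains
    the kernel of i on S. *)
Lemma dimv_quotient_image E F (i : 'Hom(E, F)) (S G : {vspace E}) :
  (G <= S)%VS -> (S :&: lker i <= G)%VS ->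
  (\dim S + \dim (i @: G) = \dim G + \dim (i @: S))%N.
Proof.
move=> GS kG; rewrite -(limg_ker_dim i S) -(limg_ker_dim i G).
suff -> : (S :&: lker i = G :&: lker i)%VS by rewrite addnAC.
by apply/eqP; rewrite eqEsubv subv_cap kG capvSr capvS.
Qed.

End LinearAlgebra.

(** * The path algebra *)

Section PathAlgebraTheory.
Variables (k : fieldType) (Q : quiver).
Local Notation A := (path_algebra k Q).
Local Notation PS := (path_space k Q).

Definition path_elt (p : qpath Q) : A := (<< p >> : PS).

Lemma path_eltM p q :
  path_elt p * path_elt q = if Defs.pcomp p q is Some r then path_elt r else 0.
Proof.
rewrite -[LHS]/(path_mul _ _) /path_elt path_mulUU mulr1 scale1r /basis_mul.
by case: (Defs.pcomp p q).
Qed.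

Lemma monomialE (c : k) (p : qpath Q) : << c *g p >> = c *: (<< p >> : PS).
Proof.
apply/malgP => r; transitivity (c *+ (p == r)); first exact: mcoeffU.
rewrite mcoeffZ -{1}[c]mulr1 -mulrnAr; congr (_ * _); exact/esym/mcoeffU.
Qed.

Lemma kscal_path (c : k) (x : PS) : kscal A c * x = (c *: x : PS) :> A.
Proof.
have U i d p : path_mul (c *: (<< trivial_path i >> : PS)) << d *g p >>
    = (c * d) *: basis_mul k (trivial_path i) p.
  by rewrite -(monomialE c) path_mulUU.
have E d p : kscal A c * (<< d *g p >> : PS) = (c *: (<< d *g p >> : PS) : PS).
  rewrite -[LHS]/(path_mul (path_scal Q c) _) /path_scal /path_one scaler_sumr.
  have -> : path_mul (\sum_i c *: (<< trivial_path i >> : PS)) << d *g p >> =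
     \sum_i path_mul (c *: (<< trivial_path i >> : PS)) << d *g p >>.
    exact: (big_morph (fun z : PS => path_mul z _)
      (fun y z => path_mulDl y z _) (@mul0r A _)).
  rewrite (bigD1 (path_end p)) //= big1 => [|i ni].
    rewrite (U (path_end p)) /basis_mul pcomp_triv_l eqxx addr0.
    by rewrite (monomialE d) scalerA.
  rewrite (U i) /basis_mul pcomp_triv_l eq_sym (negPf ni); exact: scaler0.
rewrite [x]monalgE; elim/big_rec: _ => [|p y _ yE].
  by rewrite mulr0 [RHS]scaler0.
move: (E x@_p p) => zE; set z : PS := << _ *g _ >> in zE *.
rewrite [RHS]scalerDr -[in RHS]zE -[in RHS]yE; exact: (@mulrDr A).
Qed.

Lemma path_elt_ind (P : A -> Prop) :
  P 0 -> (forall x y, P x -> P y -> P (x + y)) ->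
  (forall c p, P (kscal A c * path_elt p)) -> forall x, P x.
Proof.
move=> P0 PD Pp x; rewrite [x : PS]monalgE.
elim/big_rec: _ => [|p y _ Py]; first exact: P0.
by apply: PD => //; rewrite monomialE -kscal_path; apply: Pp.
Qed.

(** ** Linear maps given on the basis of paths *)

Section LinearExtension.
Variables (Y : lmodType k) (F : qpath Q -> Y).

Definition path_ext (x : A) : Y :=
  \sum_(p <- msupp (x : PS)) (x : PS)@_p *: F p.

Lemma path_extw (d : {fset qpath Q}) (x : PS) : (msupp x `<=` d)%fset ->
  path_ext x = \sum_(p <- d) x@_p *: F p.
Proof.
move=> s; rewrite /path_ext (big_fset_incl _ s) //= => p _ /mcoeff_outdom ->.
exact: scale0r.
Qed.

Lemma path_extD x y : path_ext (x + y) = path_ext x + path_ext y.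
Proof.
rewrite (path_extw (msuppD_le (x : PS) y)).
rewrite (path_extw (fsubsetUl (msupp (x : PS)) (msupp (y : PS)))).
rewrite (path_extw (fsubsetUr (msupp (x : PS)) (msupp (y : PS)))).
rewrite -big_split; apply: eq_bigr => p _ /=.
by rewrite mcoeffD scalerDl.
Qed.

Lemma path_extZ c (x : PS) : path_ext (c *: x) = c *: path_ext x.
Proof.
rewrite (path_extw (msuppZ_le c x)) /path_ext scaler_sumr.
by apply: eq_bigr => p _; rewrite mcoeffZ scalerA.
Qed.

Lemma path_ext_kscal c x : path_ext (kscal A c * x) = c *: path_ext x.
Proof. by rewrite kscal_path path_extZ. Qed.

Lemma path_ext_elt p : path_ext (path_elt p) = F p.
Proof. by rewrite (path_extw msuppU_le) big_seq_fset1 mcoeffUU scale1r. Qed.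

End LinearExtension.

End PathAlgebraTheory.

(** The path algebra up to isomorphism, independently of its realization by
    formal sums of paths. *)
Record path_basis (k : fieldType) (Q : quiver) (A : kalgebra k)
    (pe : qpath Q -> A) : Prop := PathBasis {
  pb_mul : forall p q,
    pe p * pe q = if Defs.pcomp p q is Some r then pe r else 0;
  pb_one : \sum_i pe (trivial_path i) = 1;
  pb_ind : forall P : A -> Prop, P 0 ->
    (forall x y, P x -> P y -> P (x + y)) ->
    (forall c p, P (kscal A c * pe p)) -> forall x, P x;
  pb_ext : forall (Y : lmodType k) (F : qpath Q -> Y), exists L : A -> Y,
    [/\ forall x y, L (x + y) = L x + L y,
        forall c x, L (kscal A c * x) = c *: L x &
        forall p, L (pe p) = F p] }.

Lemma path_algebra_basis (k : fieldType) (Q : quiver) :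
  path_basis (@path_elt k Q).
Proof.
split=> [||P|Y F]; first exact: path_eltM; first by [].
  exact: path_elt_ind.
exists (path_ext F); split; first exact: path_extD.
  exact: path_ext_kscal.
exact: path_ext_elt.
Qed.

(** * Vertices and arrows *)

Section PathBasis.
Variables (k : fieldType) (Q : quiver) (A : kalgebra k) (pe : qpath Q -> A).
Hypothesis peP : path_basis pe.

Definition vertex_elt (i : vertex Q) : A := pe (trivial_path i).
Local Notation e := vertex_elt.

Fact arrow_walk (a : arrow Q) : walk (src a) [:: a].
Proof. by rewrite /= eqxx. Qed.

Definition arrow_elt (a : arrow Q) : A :=
  pe (@QPath Q (src a, [:: a]) (arrow_walk a)).

Lemma path_elt_end i p :
  e i * pe p = if path_end p == i then pe p else 0.
Proof. by rewrite (pb_mul peP) pcomp_triv_l; case: ifP. Qed.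

Lemma path_elt_start i p :
  pe p * e i = if path_start p == i then pe p else 0.
Proof. by rewrite (pb_mul peP) pcomp_triv_r; case: ifP. Qed.

Lemma vertex_eltM i j : e i * e j = if i == j then e i else 0.
Proof. by rewrite path_elt_end eq_sym; case: (i =P j) => [->|]. Qed.

Lemma arrow_tgt a : e (tgt a) * arrow_elt a = arrow_elt a.
Proof. by rewrite path_elt_end eqxx. Qed.

Lemma arrow_src a : arrow_elt a * e (src a) = arrow_elt a.
Proof. by rewrite path_elt_start eqxx. Qed.

(** The arrows of s are traversed from left to right, so they are multiplied
    from right to left. *)
Fixpoint arrow_prod (s : seq (arrow Q)) : A :=
  if s is a :: s' then arrow_prod s' * arrow_elt a else 1.

Lemma arrow_prod_cat s s' :
  arrow_prod (s ++ s') = arrow_prod s' * arrow_prod s.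
Proof.
elim: s => [|a s IH] /=; first by rewrite mulr1.
by rewrite IH mulrA.
Qed.

Lemma path_eltE p : pe p = arrow_prod (val p).2 * e (val p).1.
Proof.
case: p => [[i s] w] /=; elim: s i w => [|a s IH] i w /=.
  rewrite mul1r; congr (pe _); exact/val_inj.
have /andP[/eqP /= si w'] := w; subst i.
rewrite -mulrA arrow_src -[arrow_elt a]arrow_tgt mulrA -(IH _ w').
rewrite (pb_mul peP).
case E: Defs.pcomp => [r|].
  by congr (pe _); apply/val_inj; move/pcompP: E => [_ ->].
have [//|r] := @pcompT Q (@QPath Q (tgt a, s) w')
  (@QPath Q (src a, [:: a]) (arrow_walk a)).
by rewrite E.
Qed.

Lemma arrow_prod_end i s j : walk i s ->
  e j * (arrow_prod s * e i) =
    if walk_end i s == j then arrow_prod s * e i else 0.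
Proof.
move=> w; have /= <- := path_eltE (@QPath Q (i, s) w); exact: path_elt_end.
Qed.

Definition path_lin (Y : lmodType k) (F : qpath Q -> Y) : A -> Y :=
  sval (cid (pb_ext peP F)).

Lemma path_linP (Y : lmodType k) (F : qpath Q -> Y) :
  [/\ forall x y, path_lin F (x + y) = path_lin F x + path_lin F y,
      forall c x, path_lin F (kscal A c * x) = c *: path_lin F x &
      forall p, path_lin F (pe p) = F p].
Proof. exact: svalP (cid (pb_ext peP F)). Qed.

Definition vertex_span : set A := kspan vertex_elt.

End PathBasis.
(** * Families of blocks of linear maps *)

Definition actf (k : fieldType) (A : kalgebra k) (M : fdmod A) (a : A) :
  'End(M) := linfun (@act _ _ M a).

Lemma actfE (k : fieldType) (A : kalgebra k) (M : fdmod A) (a : A) (m : M) :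
  actf M a m = act a m.
Proof. by rewrite lfunE. Qed.

Section Blocks.
Variables (k : fieldType) (Q : quiver) (A : kalgebra k) (pe : qpath Q -> A).
Hypothesis peP : path_basis pe.
Local Notation e := (vertex_elt pe).

Lemma sum_vertex (M : fdmod A) (m : M) : \sum_i act (e i) m = m.
Proof.
rewrite -[RHS]act1 -(pb_one peP).
elim/big_rec2: _ => [|i x y _ ->]; last by rewrite actDl.
by rewrite act0l.
Qed.

Lemma act_vertexM (M : fdmod A) i j (m : M) :
  act (e i) (act (e j) m) = if i == j then act (e i) m else 0.
Proof. by rewrite -actM (vertex_eltM peP); case: eqP => // _; rewrite act0l. Qed.

Section Families.
Variables (I : finType) (s t : I -> vertex Q) (M : fdmod A).
Implicit Types X Y : fdmod A.

Definition block_proj X (u : {ffun I -> 'Hom(X, M)}) : {ffun I -> 'Hom(X, M)} :=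
  [ffun i => (actf M (e (t i)) \o (u i \o actf X (e (s i))))%VF].

Lemma block_proj_linear X : linear (@block_proj X).
Proof.
move=> c u v; apply/ffunP => i; apply/lfunP => x.
rewrite !(ffunE, comp_lfunE, add_lfunE, scale_lfunE, actfE).
exact: linearP.
Qed.

(** The maps u_i from e_(s i) X to e_(t i) M, extended by zero to X. *)
Definition blocks X : {vspace {ffun I -> 'Hom(X, M)}} :=
  lker (lfun_of (@block_proj_linear X) - \1%VF).

Lemma blocksP X (u : {ffun I -> 'Hom(X, M)}) :
  (u \in blocks X) <->
  forall i x, act (e (t i)) (u i (act (e (s i)) x)) = u i x.
Proof.
rewrite memv_ker add_lfunE opp_lfunE id_lfunE lfun_ofE subr_eq0.
split=> [/eqP/ffunP E i x|E].
  by rewrite -[in RHS](E i) ffunE !comp_lfunE !actfE.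
by apply/eqP/ffunP => i; apply/lfunP => x; rewrite ffunE !comp_lfunE !actfE.
Qed.

Lemma blocks_tgt X u i j (x : X) : u \in blocks X ->
  act (e j) (u i x) = if j == t i then u i x else 0.
Proof.
move=> /blocksP uP; rewrite -{1}[u i x]uP act_vertexM.
by case: eqP => // ->; rewrite uP.
Qed.

Lemma blocks_src X u i j (x : X) : u \in blocks X ->
  u i (act (e j) x) = if s i == j then u i x else 0.
Proof.
move=> /blocksP uP; rewrite -[LHS]uP act_vertexM.
by case: eqP => // _; rewrite !linear0.
Qed.

Definition pull_fun X Y (q : modhom Y X) (u : {ffun I -> 'Hom(X, M)}) :
  {ffun I -> 'Hom(Y, M)} := [ffun i => (u i \o q)%VF].

Lemma pull_fun_linear X Y (q : modhom Y X) : linear (pull_fun q).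
Proof.
move=> c u v; apply/ffunP => i; apply/lfunP => x.
by rewrite !(ffunE, comp_lfunE, add_lfunE, scale_lfunE).
Qed.

Definition pull X Y (q : modhom Y X) := lfun_of (pull_fun_linear q).

Lemma pullE X Y (q : modhom Y X) u i y : pull q u i y = u i (q y).
Proof. by rewrite lfun_ofE ffunE comp_lfunE. Qed.

Lemma pull_blocks X Y (q : modhom Y X) u :
  u \in blocks X -> pull q u \in blocks Y.
Proof.
move=> /blocksP uP; apply/blocksP => i y; by rewrite !pullE mhomP uP.
Qed.

(** Blocks factor through module maps whenever the linear maps do: a linear
    pseudo-inverse of q can be cut down to blocks, since the e_i act
    semisimply. This is where the heredity of path algebras comes from. *)
Lemma pull_factor X Y (q : modhom Y X) v : v \in blocks Y ->
  (forall i y, q y = 0 -> v i y = 0) ->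
  exists2 u, u \in blocks X & pull q u = v.
Proof.
move=> vB vq; have /blocksP vP := vB.
exists (block_proj [ffun i => (v i \o q^-1)%VF]).
  apply/blocksP => i x; rewrite !ffunE !(comp_lfunE, actfE, ffunE).
  by rewrite !act_vertexM !eqxx.
have vqV i y : v i ((q^-1)%VF (q y)) = v i y.
  apply/eqP; rewrite -subr_eq0 -linearB; apply/eqP/vq.
  by rewrite linearB /= limg_lfunVK ?subrr // memv_img ?memvf.
apply/ffunP => i; apply/lfunP => y.
rewrite pullE !(ffunE, comp_lfunE, actfE).
by rewrite -mhomP vqV vP.
Qed.

Lemma pull_onto X Y (q : modhom Y X) : injective q ->
  (pull q @: blocks X)%VS = blocks Y.
Proof.
move=> qI; apply/eqP; rewrite eqEsubv; apply/andP; split; apply/subvP => v.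
  by case/memv_imgP => u uB ->; apply: pull_blocks.
move=> vB; have [i y|u uB <-] := pull_factor (q := q) vB.
  by move=> /eqP; rewrite -(linear0 q) => /eqP/qI ->; rewrite linear0.
exact: memv_img.
Qed.

(** ** Tensor products with a vector space *)

Section TensorBlocks.
Variables (T : fdmod A) (W : vectType k).

Lemma tens_eq (Y : vectType k) (F G : 'Hom(tens T W, Y)) :
  (forall t w, F (pure t w) = G (pure t w)) -> F = G.
Proof.
move=> FG.
have [||H [_ HU]] := @tens_univ k A T W Y (fun x w => F (pure x w)).
- by move=> x c v v'; rewrite pureDr pureZr linearP.
- by move=> w c x y; rewrite pureDl pureZl linearP.
by rewrite -(HU F) // -(HU G).
Qed.

Lemma coordW_linear (j : 'I_(\dim {:W})) :
  linear (coord (vbasis {:W}) j : W -> k^o).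
Proof. by move=> c x y; rewrite linearP. Qed.

Definition coordW j : 'Hom(W, k^o) := lfun_of (coordW_linear j).

Lemma coordWE j w : coordW j w = coord (vbasis {:W}) j w.
Proof. exact: lfun_ofE. Qed.

Lemma tens_in_linear w : linear (fun x : T => pure x w : tens T W).
Proof. by move=> c x y; rewrite pureDl pureZl. Qed.

Fact tens_in_hom w : Defs.Hom T (tens T W) (lfun_of (tens_in_linear w)).
Proof. by move=> b x; rewrite !lfun_ofE pure_act. Qed.

Definition tens_in w : modhom T (tens T W) := ModHom (tens_in_hom w).

Lemma tens_out_linear xi : linear (fun u : tens T W => (u : 'Hom(_, T)) xi).
Proof. by move=> c u v; rewrite add_lfunE scale_lfunE. Qed.

Fact tens_out_hom xi : Defs.Hom (tens T W) T (lfun_of (tens_out_linear xi)).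
Proof.
move=> b x; rewrite [LHS]lfun_ofE [in RHS]lfun_ofE.
by rewrite -[LHS]/(tens_act b x xi) tens_actE.
Qed.

Definition tens_out xi : modhom (tens T W) T := ModHom (tens_out_hom xi).

Lemma tens_inE w x : tens_in w x = pure x w.
Proof. exact: lfun_ofE. Qed.

Lemma tens_outE xi (u : tens T W) : tens_out xi u = (u : 'Hom(_, T)) xi.
Proof. exact: lfun_ofE. Qed.

Lemma tens_out_pure xi x w : tens_out xi (pure x w) = xi w *: x.
Proof. rewrite tens_outE; exact: pureE. Qed.

Lemma tens_sum (u : tens T W) :
  \sum_(j < \dim {:W}) tens_in (vbasis {:W})`_j (tens_out (coordW j) u) = u.
Proof.
have -> : \sum_(j < \dim {:W}) tens_in (vbasis {:W})`_j (tens_out (coordW j) u) =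
    (\sum_(j < \dim {:W}) (tens_in (vbasis {:W})`_j \o tens_out (coordW j))%VF) u.
  by rewrite sum_lfunE; apply: eq_bigr => j _; rewrite comp_lfunE.
rewrite -[RHS](id_lfunE u); congr (fun_of_lfun _ u); apply: tens_eq => x w.
rewrite sum_lfunE id_lfunE.
have xwE : pure x w = \sum_(j < \dim {:W})
    coord (vbasis {:W}) j w *: pure x (vbasis {:W})`_j.
  rewrite {1}(coord_vbasis (memvf w)).
  rewrite (big_morph (pure x) (pureDr x) (id1 := 0)) => [|].
    by apply: eq_bigr => j _; rewrite pureZr.
  by rewrite -(scale0r 0) pureZr scale0r.
rewrite [RHS]xwE.
apply: eq_bigr => j _; rewrite comp_lfunE tens_inE tens_out_pure coordWE.
exact: pureZl.
Qed.

(** The choice of a basis of W makes T (x) W a sum of copies of T. *)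
Lemma dim_blocks_tens :
  \dim (blocks (tens T W)) = (\dim {:W} * \dim (blocks T))%N.
Proof.
rewrite -[X in (X * _)%N]card_ord.
apply: (dimv_copies (i_ := fun j : 'I_(\dim {:W}) => pull (tens_out (coordW j)))
    (p_ := fun j : 'I_(\dim {:W}) => pull (tens_in (vbasis {:W})`_j))).
- move=> j x; apply/ffunP => i; apply/lfunP => y.
  rewrite !pullE tens_inE tens_out_pure coordWE.
  by rewrite coord_free ?(basis_free (vbasisP _)) // eqxx scale1r.
- move=> j l x jl; apply/ffunP => i; apply/lfunP => y.
  rewrite !pullE tens_inE tens_out_pure coordWE !ffunE lfunE.
  rewrite coord_free ?(basis_free (vbasisP _)) // (negPf jl) scale0r.
  exact: linear0.
- move=> v; apply/ffunP => i; apply/lfunP => y.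
  rewrite sum_ffunE sum_lfunE -[in RHS](tens_sum y) linear_sum.
  by apply: eq_bigr => j _; rewrite !pullE.
- by move=> j x; apply: pull_blocks.
- by move=> j x; apply: pull_blocks.
Qed.

End TensorBlocks.

End Families.
End Blocks.

(** * Derivations of the path algebra *)

Section Derivations.
Variables (k : fieldType) (Q : quiver) (A : kalgebra k) (pe : qpath Q -> A).
Hypothesis peP : path_basis pe.
Local Notation e := (vertex_elt pe).
Local Notation arr := (arrow_elt pe).
Implicit Types X Y M : fdmod A.

Definition arrow_blocks M X := blocks pe (@src Q) (@tgt Q) M X.

Lemma kspan_gen (B : kalgebra k) (I : finType) (s : I -> B) i : kspan s (s i).
Proof.
exists (fun j => (j == i)%:R); rewrite (bigD1 i) //= eqxx rmorph1 mul1r.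
by rewrite big1 ?addr0 // => j /negPf ->; rewrite rmorph0 mul0r.
Qed.

Section DerTheory.
Variables (B : kalgebra k) (S : set B) (N M : fdmod B) (d : B -> 'Hom(N, M)).

(** The conditions defining [Der] compare the underlying functions. *)
Lemma DerP : Der S N M d <->
  [/\ forall a b, d (a + b) = d a + d b,
      forall c b, d (kscal B c * b) = c *: d b,
      forall a b n, d (a * b) n = act a (d b n) + d a (act b n) &
      forall s, S s -> d s = 0].
Proof.
split=> [] [dD dZ dM dS].
  split=> // [a b|c b|s Ss]; apply/lfunP => n.
  - by move/(congr1 (@^~ n)): (dD a b); rewrite add_lfunE.
  - by move/(congr1 (@^~ n)): (dZ c b); rewrite scale_lfunE.
  by move/(congr1 (@^~ n)): (dS s Ss); rewrite lfunE.
split=> // [a b|c b|s /dS ->]; apply/funext => n.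
- by rewrite dD add_lfunE.
- by rewrite dZ scale_lfunE.
by rewrite lfunE.
Qed.

Hypothesis dP : Der S N M d.

Lemma derD a b : d (a + b) = d a + d b.
Proof. by case/DerP: dP => + _ _ _; apply. Qed.
Lemma derZ c b : d (kscal B c * b) = c *: d b.
Proof. by case/DerP: dP => _ + _ _; apply. Qed.
Lemma derM a b n : d (a * b) n = act a (d b n) + d a (act b n).
Proof. by case/DerP: dP => _ _ + _; apply. Qed.
Lemma derS s : S s -> d s = 0. Proof. by case/DerP: dP => _ _ _; apply. Qed.
Lemma der0 : d 0 = 0.
Proof. by apply: (addIr (d 0)); rewrite -derD !add0r. Qed.
Lemma der_sum (I : finType) (F : I -> B) : d (\sum_i F i) = \sum_i d (F i).
Proof. exact: (big_morph d derD der0). Qed.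

End DerTheory.

Lemma Der_vertex M X d i : Der (vertex_span pe) X M d -> d (e i) = 0.
Proof. by move=> dP; apply: (derS dP); apply: kspan_gen. Qed.

Lemma Der_one M X d : Der (vertex_span pe) X M d -> d 1 = 0.
Proof.
move=> dP; rewrite -(pb_one peP) (der_sum dP) big1 // => i _.
exact: Der_vertex dP.
Qed.

(** The vertices and the arrows generate the algebra. *)
Lemma Der_eq M X d d' :
  Der (vertex_span pe) X M d -> Der (vertex_span pe) X M d' ->
  (forall a, d (arr a) = d' (arr a)) -> d =1 d'.
Proof.
move=> dP dP' da.
have M2 a b : d a = d' a -> d b = d' b -> d (a * b) = d' (a * b).
  by move=> Ha Hb; apply/lfunP => x; rewrite (derM dP) (derM dP') Ha Hb.
apply: (pb_ind peP) => [|x y xE yE|c p].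
- by rewrite (der0 dP) (der0 dP').
- by rewrite (derD dP) (derD dP') xE yE.
rewrite (derZ dP) (derZ dP'); congr (_ *: _); rewrite (path_eltE peP).
apply: (M2); last by rewrite (Der_vertex _ dP) (Der_vertex _ dP').
elim: (val p).2 => [|a s IH] /=; first by rewrite (Der_one dP) (Der_one dP').
exact: M2.
Qed.

Section Extension.
Variables X M : fdmod A.
Implicit Types u : {ffun arrow Q -> 'Hom(X, M)}.

(** The Leibniz rule along a list of arrows. *)
Fixpoint leibniz u (s : seq (arrow Q)) : 'Hom(X, M) :=
  if s is a :: s' then
    ((actf M (arrow_prod pe s') \o u a) + (leibniz u s' \o actf X (arr a)))%VF
  else 0.

Lemma leibniz_cons u a s x : leibniz u (a :: s) x =
  act (arrow_prod pe s) (u a x) + leibniz u s (act (arr a) x).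
Proof. by rewrite /= add_lfunE !comp_lfunE !actfE. Qed.

Lemma leibniz_cat u s s' x : leibniz u (s ++ s') x =
  act (arrow_prod pe s') (leibniz u s x) + leibniz u s' (act (arrow_prod pe s) x).
Proof.
elim: s x => [|a s IH] x; first by rewrite /= lfunE /= linear0 add0r act1.
rewrite cat_cons !leibniz_cons IH arrow_prod_cat actM [in RHS]linearD /= actM.
by rewrite addrA.
Qed.

Lemma leibniz_end u i s j x : u \in arrow_blocks M X -> walk i s ->
  act (e j) (leibniz u s (act (e i) x)) =
    if walk_end i s == j then leibniz u s (act (e i) x) else 0.
Proof.
move=> uB; elim: s i x => [|a s IH] i x w.
  by rewrite /= lfunE /= linear0; case: ifP.
have /andP[/eqP si w'] := w.
have aE y : act (arr a) y = act (e (tgt a)) (act (arr a) y).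
  by rewrite -actM (arrow_tgt peP).
have uE y : u a y = act (e (tgt a)) (u a y).
  by rewrite (blocks_tgt peP _ _ _ uB) eqxx.
rewrite !leibniz_cons linearD /= aE (IH _ _ w') uE -!actM -!mulrA.
rewrite (arrow_prod_end peP _ w') -[walk_end i _]/(walk_end (tgt a) s).
by case: ifP => // _; rewrite act0l addr0.
Qed.

Lemma leibniz_linear s : linear (leibniz^~ s).
Proof.
elim: s => [|a s IH] c u v; first by rewrite /= scaler0 addr0.
apply/lfunP => x; rewrite [RHS]add_lfunE [in RHS]scale_lfunE !leibniz_cons IH.
rewrite !(ffunE, add_lfunE, scale_lfunE) linearP scalerDr.
by rewrite addrACA.
Qed.

Definition path_der u (p : qpath Q) : 'Hom(X, M) :=
  (leibniz u (val p).2 \o actf X (e (val p).1))%VF.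

Definition der_of u : A -> 'Hom(X, M) := path_lin peP (path_der u).

Lemma der_ofD u a b : der_of u (a + b) = der_of u a + der_of u b.
Proof. by case: (path_linP peP (path_der u)) => + _ _; apply. Qed.

Lemma der_ofZ u c a : der_of u (kscal A c * a) = c *: der_of u a.
Proof. by case: (path_linP peP (path_der u)) => _ + _; apply. Qed.

Lemma der_of_path u p : der_of u (pe p) = path_der u p.
Proof. by case: (path_linP peP (path_der u)) => _ _ +; apply. Qed.

Lemma der_of0 u : der_of u 0 = 0.
Proof. by apply: (addIr (der_of u 0)); rewrite -der_ofD !add0r. Qed.

Lemma path_der_linear p : linear (path_der^~ p).
Proof.
move=> c u v; apply/lfunP => x.
by rewrite /path_der leibniz_linear !(add_lfunE, scale_lfunE, comp_lfunE).
Qed.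

Lemma der_of_linear : linear der_of.
Proof.
move=> c u v; apply/funext => a.
change (der_of (c *: u + v) a = c *: der_of u a + der_of v a).
move: a; apply: (pb_ind peP) => [|x y xE yE|b p].
- by rewrite !der_of0 scaler0 addr0.
- by rewrite !der_ofD xE yE scalerDr addrACA.
by rewrite !der_ofZ !der_of_path path_der_linear scalerDr !scalerA mulrC.
Qed.

Lemma path_der_mul u p q x : u \in arrow_blocks M X ->
  der_of u (pe p * pe q) x =
    act (pe p) (der_of u (pe q) x) + der_of u (pe p) (act (pe q) x).
Proof.
move=> uB; rewrite (pb_mul peP) !der_of_path !comp_lfunE !actfE.
have qE y : act (pe q) y =
    act (arrow_prod pe (val q).2) (act (e (val q).1) y).
  by rewrite -actM -(path_eltE peP).
have pE : pe p = arrow_prod pe (val p).2 * e (path_start p).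
  exact: path_eltE.
have pqE y : act (e (path_start p)) (act (pe q) y) =
    if path_end q == path_start p then act (pe q) y else 0.
  by rewrite -actM (path_elt_end peP); case: eqP => // _; rewrite act0l.
rewrite pqE pE actM (leibniz_end _ _ uB (valP q)).
rewrite -[walk_end _ _]/(path_end q).
have [qp|nqp] := eqVneq (path_end q) (path_start p); last first.
  by rewrite pcompN // der_of0 lfunE /= !linear0 addr0.
have [r rE] := pcompT qp; rewrite rE der_of_path comp_lfunE actfE.
by move/pcompP: rE => [_ ->] /=; rewrite leibniz_cat qE.
Qed.

(** A derivation vanishing on the vertices takes arbitrary values on the
    arrows, within the blocks: the path algebra is the tensor algebra of its
    arrow bimodule over the span of the vertices. *)
Lemma der_of_Der u : u \in arrow_blocks M X ->
  Der (vertex_span pe) X M (der_of u).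
Proof.
move=> uB; apply/DerP; split; [exact: der_ofD | exact: der_ofZ | |].
  move=> a b; move: a; apply: (pb_ind peP) => [x|a a' aE aE' x|c p].
  - by rewrite mul0r der_of0 act0l !zero_lfunE addr0.
  - rewrite mulrDl !der_ofD !add_lfunE aE aE' actDl.
    by rewrite addrACA.
  move: b; apply: (pb_ind peP) => [x|b b' bE bE' x|c' q x].
  - by rewrite mulr0 der_of0 act0l !zero_lfunE !linear0 addr0.
  - rewrite mulrDr !der_ofD !add_lfunE bE bE' actDl !linearD /=.
    by rewrite addrACA.
  have -> : kscal A c * pe p * (kscal A c' * pe q)
      = kscal A c * (kscal A c' * (pe p * pe q)).
    by rewrite -!mulrA; congr (_ * _); rewrite !mulrA kscalC.
  rewrite !der_ofZ !scale_lfunE path_der_mul // !actM !actZ.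
  by rewrite !linearZ /= -!scalerDr.
move=> _ [c ->]; rewrite (big_morph _ (der_ofD u) (der_of0 u)) big1 // => i _.
rewrite der_ofZ der_of_path; apply/lfunP => x.
by rewrite scale_lfunE comp_lfunE !lfunE /= scaler0.
Qed.

Lemma der_of_arrow u a : u \in arrow_blocks M X -> der_of u (arr a) = u a.
Proof.
move=> uB; apply/lfunP => x; rewrite der_of_path comp_lfunE actfE leibniz_cons.
by rewrite act1 lfunE /= addr0 (blocks_src peP _ _ _ uB) eqxx.
Qed.

Definition der_data (d : A -> 'Hom(X, M)) : {ffun arrow Q -> 'Hom(X, M)} :=
  [ffun a => d (arr a)].

Lemma der_data_blocks d :
  Der (vertex_span pe) X M d -> der_data d \in arrow_blocks M X.
Proof.
move=> dP; apply/blocksP => a x; rewrite !ffunE.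
rewrite -[in RHS](arrow_tgt peP) -[in RHS](arrow_src peP).
rewrite (derM dP) (derM dP) (Der_vertex _ dP) (Der_vertex _ dP).
by rewrite !lfunE /= linear0 !(addr0, add0r).
Qed.

Lemma der_dataK d : Der (vertex_span pe) X M d -> der_of (der_data d) = d.
Proof.
move=> dP; have uB := der_data_blocks dP.
apply/funext/(Der_eq (der_of_Der uB) dP) => a.
by rewrite der_of_arrow // ffunE.
Qed.

Lemma is_qdim_Der :
  is_qdim (Der (vertex_span pe) X M) [set 0]%classic (\dim (arrow_blocks M X)).
Proof.
apply: (is_qdim_isom der_of_linear) => [u|d dP|u uB u0].
- exact: der_of_Der.
- by exists (der_data d); rewrite ?der_dataK //; apply: der_data_blocks.
by apply/ffunP => a; rewrite -(der_of_arrow _ uB) u0 ffunE.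
Qed.

(** ** Inner derivations *)

Definition inner (h : 'Hom(X, M)) (a : A) : 'Hom(X, M) :=
  ((actf M a \o h) - (h \o actf X a))%VF.

Lemma innerE (h : 'Hom(X, M)) a x : inner h a x = act a (h x) - h (act a x).
Proof. by rewrite add_lfunE opp_lfunE !comp_lfunE !actfE. Qed.

Lemma inner_Der (h : 'Hom(X, M)) :
  (forall i x, act (e i) (h x) = h (act (e i) x)) ->
  Der (vertex_span pe) X M (inner h).
Proof.
move=> hP; have iD a b : inner h (a + b) = inner h a + inner h b.
  apply/lfunP => x; rewrite add_lfunE !innerE !actDl linearD opprD.
  by rewrite addrACA.
have iZ c b : inner h (kscal A c * b) = c *: inner h b.
  apply/lfunP => x; rewrite scale_lfunE !innerE !actM !actZ linearZ.
  by rewrite scalerBr.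
apply/DerP; split=> // [a b x|_ [c ->]].
  by rewrite !innerE !actM linearB /= addrA subrK.
have i0 : inner h 0 = 0 by apply: (addIr (inner h 0)); rewrite -iD !add0r.
rewrite (big_morph _ iD i0) big1 // => i _; rewrite iZ.
have -> : inner h (e i) = 0; last exact: scaler0.
by apply/lfunP => x; rewrite innerE hP subrr lfunE.
Qed.

End Extension.
End Derivations.

(** * The two-term complex of a pair of representations *)

Section Complex.
Variables (k : fieldType) (Q : quiver) (A : kalgebra k) (pe : qpath Q -> A).
Hypothesis peP : path_basis pe.
Local Notation e := (vertex_elt pe).
Local Notation arr := (arrow_elt pe).

Definition vertex_blocks M X := blocks pe (@id (vertex Q)) id M X.

Section Coboundary.
Variables X M : fdmod A.
Implicit Types h : {ffun vertex Q -> 'Hom(X, M)}.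

Definition block_sum h : 'Hom(X, M) := \sum_i h i.

Lemma block_sumE h x : block_sum h x = \sum_i h i x.
Proof. by rewrite sum_lfunE. Qed.

Lemma block_sum_linear : linear block_sum.
Proof.
move=> c h h'; rewrite /block_sum scaler_sumr -big_split; apply: eq_bigr => i _.
by rewrite !ffunE.
Qed.

Lemma block_sum_tgt h i x : h \in vertex_blocks M X ->
  act (e i) (block_sum h x) = h i x.
Proof.
move=> hB; rewrite block_sumE linear_sum (bigD1 i) //= big1 ?addr0 => [|j ji].
  by rewrite (blocks_tgt peP _ _ _ hB) eqxx.
by rewrite (blocks_tgt peP _ _ _ hB) eq_sym (negPf ji).
Qed.

Lemma block_sum_src h i x : h \in vertex_blocks M X ->
  block_sum h (act (e i) x) = h i x.
Proof.
move=> hB; rewrite block_sumE (bigD1 i) //= big1 ?addr0 => [|j ji].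
  by rewrite (blocks_src peP _ _ _ hB) eqxx.
by rewrite (blocks_src peP _ _ _ hB) (negPf ji).
Qed.

Lemma block_sum_comm h i x : h \in vertex_blocks M X ->
  act (e i) (block_sum h x) = block_sum h (act (e i) x).
Proof. by move=> hB; rewrite block_sum_tgt // block_sum_src. Qed.

Definition vertex_split (h : 'Hom(X, M)) : {ffun vertex Q -> 'Hom(X, M)} :=
  [ffun i => (h \o actf X (e i))%VF].

Lemma vertex_splitK (h : 'Hom(X, M)) : block_sum (vertex_split h) = h.
Proof.
apply/lfunP => x; rewrite block_sumE -[in RHS](sum_vertex peP x) linear_sum.
by apply: eq_bigr => i _; rewrite ffunE comp_lfunE actfE.
Qed.

Lemma vertex_split_blocks (h : 'Hom(X, M)) :
  (forall i x, act (e i) (h x) = h (act (e i) x)) ->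
  vertex_split h \in vertex_blocks M X.
Proof.
move=> hP; apply/blocksP => i x; rewrite !ffunE !comp_lfunE !actfE.
by rewrite hP !(act_vertexM peP) !eqxx.
Qed.

Definition cobd_fun h : {ffun arrow Q -> 'Hom(X, M)} :=
  der_data pe (inner (block_sum h)).

Lemma cobd_funE h a x :
  cobd_fun h a x = act (arr a) (block_sum h x) - block_sum h (act (arr a) x).
Proof. by rewrite ffunE innerE. Qed.

Lemma cobd_linear : linear cobd_fun.
Proof.
move=> c h h'; apply/ffunP => a; apply/lfunP => x.
have -> (F G : {ffun arrow Q -> 'Hom(X, M)}) :
    (c *: F + G) a x = c *: F a x + G a x.
  by rewrite !ffunE add_lfunE scale_lfunE.
rewrite !cobd_funE block_sum_linear !(add_lfunE, scale_lfunE) linearP.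
rewrite scalerBr opprD.
by rewrite addrACA.
Qed.

(** The coboundary (h_i)_i |-> (arr_a h_(src a) - h_(tgt a) arr_a)_a from vertex
    blocks to arrow blocks. Its kernel is Hom(X, M) and its cokernel is
    Ext^1(X, M). *)
Definition cobd := lfun_of cobd_linear.

Lemma cobdE h : cobd h = der_data pe (inner (block_sum h)).
Proof. exact: lfun_ofE. Qed.

Lemma block_sum_Der h : h \in vertex_blocks M X ->
  Der (vertex_span pe) X M (inner (block_sum h)).
Proof. by move=> hB; apply: inner_Der => i x; apply: block_sum_comm. Qed.

Lemma cobd_blocks h : h \in vertex_blocks M X -> cobd h \in arrow_blocks pe M X.
Proof.
move=> hB; rewrite cobdE; apply: der_data_blocks => //; exact: block_sum_Der.
Qed.

Lemma der_of_cobd h : h \in vertex_blocks M X ->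
  der_of peP (cobd h) = inner (block_sum h).
Proof. by move=> hB; rewrite cobdE der_dataK //; apply: block_sum_Der. Qed.

Lemma is_qdim_Hom :
  is_qdim (Defs.Hom X M) [set 0]%classic (\dim (vertex_blocks M X :&: lker cobd)).
Proof.
apply: (is_qdim_isom block_sum_linear) => [h|f fP|h].
- case/memv_capP => hB; rewrite memv_ker => /eqP h0 b x.
  have i0 a y : inner (0 : 'Hom(X, M)) a y = 0.
    by rewrite innerE !zero_lfunE linear0 subrr.
  have h0P : Der (vertex_span pe) X M (inner 0).
    by apply: inner_Der => i y; rewrite !zero_lfunE linear0.
  have hE a : inner (block_sum h) (arr a) = inner 0 (arr a).
    apply/lfunP => y; rewrite i0.
    have /ffunP/(_ a) := cobdE h; rewrite h0 ffunE => /esym.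
    by rewrite ffunE => ->; rewrite zero_lfunE.
  have /lfunP/(_ x) := Der_eq peP (block_sum_Der hB) h0P hE b.
  by rewrite i0 innerE => /eqP; rewrite subr_eq0 => /eqP.
- have fB : vertex_split f \in vertex_blocks M X.
    by apply: vertex_split_blocks => i x; rewrite fP.
  exists (vertex_split f); last by rewrite vertex_splitK.
  rewrite memv_cap fB memv_ker cobdE vertex_splitK; apply/eqP/ffunP => a.
  by apply/lfunP => x; rewrite !ffunE innerE fP subrr lfunE.
case/memv_capP => hB _ h0; apply/ffunP => i; apply/lfunP => x.
by rewrite -(block_sum_tgt _ _ hB) h0 ffunE !lfunE /= linear0.
Qed.

End Coboundary.

(** ** Extensions as classes of derivations *)

Section Ext.
Variables X M : fdmod A.
Local Notation n := (\dim {:X}).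
Local Notation b_ i := ((vbasis {:X})`_i : X).

Section FromDerivation.
Variable d : A -> 'Hom(X, M).

(** The twisted action a (m, x) = (a m + d(a) x, a x) makes M + X an extension
    of X by M; this is the first component of the lift to A^n -> M + X of the
    presentation of X. *)
Definition lift_der (x : 'rV[A]_n) : M := \sum_i d (x 0 i) (b_ i).

Hypothesis dP : Der (vertex_span pe) X M d.

Lemma lift_derD b x y :
  lift_der (b *: x + y) = act b (lift_der x) + d b (pres x) + lift_der y.
Proof.
rewrite /lift_der linear_sum linear_sum -!big_split; apply: eq_bigr => i _ /=.
by rewrite !mxE (derD dP) add_lfunE (derM dP).
Qed.

End FromDerivation.

Lemma presD1 (x y : 'rV[A]_n) b :
  pres (b *: x + y) = act b (pres x) + pres y.
Proof. by rewrite presD presZ. Qed.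

Lemma pres0 : pres (0 : 'rV[A]_n) = 0.
Proof. by rewrite /pres big1 // => i _; rewrite mxE act0l. Qed.

(** *** A linear section of the presentation, equivariant for the vertices *)

Definition coord_row (m : X) : 'rV[A]_n :=
  \row_i kscal A (coord (vbasis {:X}) i m).

Lemma coord_rowD c m m' :
  coord_row (c *: m + m') = kscal A c *: coord_row m + coord_row m'.
Proof. by apply/rowP => i; rewrite !mxE linearP rmorphD rmorphM. Qed.

Lemma coord_row0 : coord_row 0 = 0.
Proof. by apply/rowP => i; rewrite !mxE linear0 rmorph0. Qed.

Lemma pres_coord_row m : pres (coord_row m) = m.
Proof.
rewrite [RHS](coord_vbasis (memvf m)); apply: eq_bigr => i _.
by rewrite mxE actZ.
Qed.

(** Averaging over the vertices makes the section equivariant for them, so that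
    the derivations built from it vanish on the vertices. *)
Definition sec (m : X) : 'rV[A]_n := \sum_i e i *: coord_row (act (e i) m).

Lemma secD c m m' : sec (c *: m + m') = kscal A c *: sec m + sec m'.
Proof.
rewrite /sec scaler_sumr -big_split; apply: eq_bigr => i _ /=.
by rewrite linearP coord_rowD scalerDr !scalerA kscalC.
Qed.

Lemma sec_add m m' : sec (m + m') = sec m + sec m'.
Proof. by have := secD 1 m m'; rewrite scale1r rmorph1 scale1r. Qed.

Lemma sec0 : sec 0 = 0.
Proof. by apply: (addIr (sec 0)); rewrite -sec_add !add0r. Qed.

Lemma sec_sum (I : finType) (F : I -> X) : sec (\sum_i F i) = \sum_i sec (F i).
Proof. exact: (big_morph sec sec_add sec0). Qed.

Lemma sec_vertex i m : e i *: sec m = sec (act (e i) m).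
Proof.
rewrite /sec scaler_sumr; apply: eq_bigr => j _.
rewrite scalerA (vertex_eltM peP) (act_vertexM peP) eq_sym.
by case: eqP => [->|] //; rewrite coord_row0 scaler0 scale0r.
Qed.

Lemma pres_sec m : pres (sec m) = m.
Proof.
rewrite /sec (big_morph _ (@presD _ _ X) pres0) -[RHS](sum_vertex peP).
apply: eq_bigr => i _; rewrite presZ pres_coord_row.
by rewrite (act_vertexM peP) eqxx.
Qed.

(** *** From maps on the syzygy to derivations *)

Section FromSyzygy.
Variable h : syzygy X -> M.
Hypothesis hL : syz_hom h.

Definition syz_fun (x : 'rV[A]_n) : M := oapp h 0 (insub x).

Lemma syz_funE (x : syzygy X) : syz_fun (val x) = h x.
Proof. by rewrite /syz_fun valK. Qed.

Lemma syz_fun_lin b x y : pres x = 0 -> pres y = 0 ->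
  syz_fun (b *: x + y) = act b (syz_fun x) + syz_fun y.
Proof.
move=> /eqP x0 /eqP y0.
have xE : x = val (Syzygy (x0 : x \in @syzygy_pred _ _ X)) by [].
have yE : y = val (Syzygy (y0 : y \in @syzygy_pred _ _ X)) by [].
rewrite [in LHS]xE [in LHS]yE.
rewrite -[_ *: _ + _]/(val (b *: Syzygy x0 + Syzygy y0)) syz_funE hL.
by rewrite -!syz_funE.
Qed.

Lemma syz_fun0 : syz_fun 0 = 0.
Proof.
have := syz_fun_lin 1 pres0 pres0; rewrite scaler0 addr0 act1 => zE.
by apply: (addIr (syz_fun 0)); rewrite add0r -zE.
Qed.

Lemma syz_funD x y : pres x = 0 -> pres y = 0 ->
  syz_fun (x + y) = syz_fun x + syz_fun y.
Proof. by move=> x0 y0; rewrite -{1}[x]scale1r syz_fun_lin // act1. Qed.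

Lemma syz_fun_sum (I : finType) (F : I -> 'rV[A]_n) :
  (forall i, pres (F i) = 0) ->
  syz_fun (\sum_i F i) = \sum_i syz_fun (F i).
Proof.
move=> F0; suff [] : pres (\sum_i F i) = 0 /\
  syz_fun (\sum_i F i) = \sum_i syz_fun (F i) by [].
elim/big_rec2: _ => [|i x y _ [y0 yE]]; first by rewrite pres0 syz_fun0.
by rewrite presD F0 y0 addr0 syz_funD // yE.
Qed.

(** The defect of A-linearity of the section lies in the syzygy. *)
Definition defect (a : A) (m : X) : 'rV[A]_n := a *: sec m - sec (act a m).

Lemma pres_defect a m : pres (defect a m) = 0.
Proof.
rewrite /defect -scaleN1r addrC presD1 presZ !pres_sec.
have -> : act (- 1) (act a m) = - act a m.
  by apply: (addIr (act a m)); rewrite addNr -{2}[act a m]act1 -actDl addNr act0l.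
by rewrite addNr.
Qed.

Lemma defectDr a c m m' :
  defect a (c *: m + m') = kscal A c *: defect a m + defect a m'.
Proof.
rewrite /defect secD linearP secD scalerDr scalerBr !scalerA -kscalC.
by rewrite opprD addrACA.
Qed.

Lemma defectD a b m : defect (a + b) m = defect a m + defect b m.
Proof. by rewrite /defect scalerDl actDl sec_add opprD addrACA. Qed.

Lemma defectZ c a m : defect (kscal A c * a) m = kscal A c *: defect a m.
Proof.
rewrite /defect actM actZ -[c *: _]addr0 secD sec0 addr0 scalerBr.
by rewrite scalerA.
Qed.

Lemma defectM a b m : defect (a * b) m = a *: defect b m + defect a (act b m).
Proof. by rewrite /defect scalerBr scalerA actM addrA subrK. Qed.

Lemma der_syz_linear a : linear (fun m => syz_fun (defect a m)).
Proof.
by move=> c m m'; rewrite defectDr syz_fun_lin ?pres_defect // actZ.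
Qed.

(** The cocycle of the extension obtained by pushing the presentation of X out
    along h. *)
Definition der_syz (a : A) : 'Hom(X, M) := lfun_of (der_syz_linear a).

Lemma der_syzE a m : der_syz a m = syz_fun (defect a m).
Proof. exact: lfun_ofE. Qed.

Lemma der_syz_Der : Der (vertex_span pe) X M der_syz.
Proof.
have dD a b : der_syz (a + b) = der_syz a + der_syz b.
  apply/lfunP => m; rewrite add_lfunE !der_syzE defectD.
  by rewrite syz_funD ?pres_defect.
have dZ c b : der_syz (kscal A c * b) = c *: der_syz b.
  apply/lfunP => m; rewrite scale_lfunE !der_syzE defectZ -[_ *: _]addr0.
  by rewrite syz_fun_lin ?pres_defect ?pres0 // syz_fun0 addr0 actZ.
have d0 : der_syz 0 = 0 by apply: (addIr (der_syz 0)); rewrite -dD !add0r.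
apply/DerP; split=> // [a b m|_ [c ->]].
  by rewrite !der_syzE defectM syz_fun_lin ?pres_defect.
rewrite (big_morph _ dD d0) big1 // => i _; rewrite dZ.
apply/lfunP => m; rewrite scale_lfunE der_syzE /defect sec_vertex subrr.
by rewrite syz_fun0 scaler0 zero_lfunE.
Qed.

(** On the syzygy, h differs from the map of its derivation by the restriction
    of x |-> h (x - sum_i x_i sec(b_i)), which is defined on all of A^n. *)
Lemma syz_sub_der :
  syz_ext (h - (fun x => lift_der der_syz (syz_val x)) : syzygy X -> M).
Proof.
pose p (x : 'rV[A]_n) := x - \sum_i x 0 i *: sec (b_ i).
have p0 x : pres (p x) = 0.
  have -> : p x = (-1) *: (\sum_i x 0 i *: sec (b_ i)) + x.
    by rewrite scaleN1r addrC.
  rewrite presD1 (big_morph _ (@presD _ _ X) pres0).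
  have -> : \sum_i pres (x 0 i *: sec (b_ i)) = pres x.
    by apply: eq_bigr => i _; rewrite presZ pres_sec.
  by rewrite -{2}[pres x]act1 -actDl addNr act0l.
have pL b x y : p (b *: x + y) = b *: p x + p y.
  rewrite /p scalerBr addrACA -opprD; congr (_ - _).
  rewrite scaler_sumr -big_split; apply: eq_bigr => i _ /=.
  by rewrite !mxE scalerDl scalerA.
exists (fun x => syz_fun (p x)); split=> [b x y|x].
  by rewrite pL syz_fun_lin.
change (h x - lift_der der_syz (syz_val x) = syz_fun (p (syz_val x))).
have x0 : pres (syz_val x) = 0 by exact/eqP/(syz_valP x).
have s0 : \sum_i defect (syz_val x 0 i) (b_ i)
    = \sum_i syz_val x 0 i *: sec (b_ i).
  rewrite sumrB -sec_sum -[\sum_i act _ _]/(pres (syz_val x)) x0 sec0.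
  by rewrite subr0.
apply/eqP; rewrite subr_eq -syz_funE; apply/eqP.
have -> : lift_der der_syz (syz_val x)
    = syz_fun (\sum_i syz_val x 0 i *: sec (b_ i)).
  rewrite -s0 syz_fun_sum => [|i]; last exact: pres_defect.
  by apply: eq_bigr => i _; rewrite der_syzE.
rewrite -syz_funD ?p0 //; first by rewrite subrK.
rewrite (big_morph _ (@presD _ _ X) pres0) -[RHS]x0.
by apply: eq_bigr => i _; rewrite presZ pres_sec.
Qed.

End FromSyzygy.

Definition syz_of_der (d : A -> 'Hom(X, M)) : syzygy X -> M :=
  fun x => lift_der d (syz_val x).

Lemma syz_of_der_hom d :
  Der (vertex_span pe) X M d -> syz_hom (syz_of_der d).
Proof.
move=> dP b x y; rewrite /syz_of_der.
rewrite -[syz_val (_ + _)]/(b *: syz_val x + syz_val y) (lift_derD dP).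
by have /eqP -> : pres (syz_val x) == 0 := syz_valP x; rewrite linear0 addr0.
Qed.

(** The map of a derivation extends to A^n if and only if the extension
    splits, that is, if and only if the derivation is inner. *)
Lemma syz_of_der_inner (f : 'Hom(X, M)) : syz_ext (syz_of_der (inner f)).
Proof.
exists (fun x : 'rV[A]_n => \sum_i act (x 0 i) (f (b_ i))); split=> [b x y|x].
  rewrite linear_sum -big_split; apply: eq_bigr => i _ /=.
  by rewrite !mxE actDl actM.
have /eqP x0 : pres (syz_val x) == 0 := syz_valP x.
have fx0 : \sum_i f (act (syz_val x 0 i) (b_ i)) = 0.
  by rewrite -linear_sum -[\sum_i _]/(pres (syz_val x)) x0 linear0.
rewrite -[RHS]subr0 -[X in _ - X]fx0 -sumrB.
by apply: eq_bigr => i _; rewrite innerE.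
Qed.

Lemma inner_of_syz_ext d :
  Der (vertex_span pe) X M d -> syz_ext (syz_of_der d) ->
  exists f : 'Hom(X, M), d =1 inner f.
Proof.
move=> dP [h' [h'L h'E]].
pose th x := lift_der d x - h' x.
(* th is a lift of the presentation to the extension minus a linear map that
   agrees with it on the syzygy, so it descends to X and splits the
   extension. *)
have thL b x y : th (b *: x + y) = act b (th x) + d b (pres x) + th y.
  rewrite /th (lift_derD dP) h'L linearB /= opprD addrACA.
  by congr (_ + _); exact: addrAC.
have d1 : d 1 = 0 by exact: Der_one dP.
have thD x y : th (x + y) = th x + th y.
  by rewrite -{1}[x]scale1r thL act1 d1 zero_lfunE addr0.
have th0 x : pres x = 0 -> th x = 0.
  move=> /eqP x0; have := h'E (Syzygy (x0 : x \in @syzygy_pred _ _ X)).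
  by rewrite /th /syz_of_der /= => ->; rewrite subrr.
have thE x : th x = th (sec (pres x)).
  rewrite -{1}[x](subrK (sec (pres x))) thD th0 ?add0r //.
  rewrite addrC -scaleN1r presD1 pres_sec -{2}[pres x]act1 -actDl.
  by rewrite addNr act0l.
have psiL : linear (th \o sec).
  move=> c m m'; rewrite /= secD thL actZ; congr (_ + _).
  by rewrite -[kscal A c]mulr1 (derZ dP) d1 scaler0 zero_lfunE addr0.
exists (- lfun_of psiL) => b; apply/lfunP => m.
rewrite innerE !opp_lfunE !lfun_ofE /= opprK linearN /=.
have -> : th (sec (act b m)) = th (b *: sec m).
  by rewrite [RHS]thE presZ pres_sec.
rewrite -[b *: _]addr0 thL pres_sec (th0 0) ?pres0 // addr0.
by rewrite addrA addNr add0r.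
Qed.

Lemma syz_ext_subspace : is_subspace (@syz_ext _ _ X M).
Proof.
split=> [|c h1 h2 [f1 [f1L f1E]] [f2 [f2L f2E]]].
  by exists (fun=> 0); split=> // b x y; rewrite linear0 addr0.
exists (fun x => c *: f1 x + f2 x); split=> [b x y|x].
  rewrite f1L f2L scalerDr linearD /= linearZ /=.
  by rewrite addrACA.
by rewrite -f1E -f2E.
Qed.

Lemma syz_of_der_linear :
  linear (fun u => syz_of_der (der_of peP u) : syzygy X -> M).
Proof.
move=> c u v; apply/funext => x; rewrite der_of_linear.
change (lift_der (c *: der_of peP u + der_of peP v) (syz_val x) =
  c *: lift_der (der_of peP u) (syz_val x)
  + lift_der (der_of peP v) (syz_val x)).
rewrite /lift_der scaler_sumr -big_split; apply: eq_bigr => i _ /=.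
change ((c *: der_of peP u (syz_val x 0 i) + der_of peP v (syz_val x 0 i)) (b_ i)
  = c *: der_of peP u (syz_val x 0 i) (b_ i)
    + der_of peP v (syz_val x 0 i) (b_ i)).
by rewrite add_lfunE scale_lfunE.
Qed.

Lemma is_qdim_Ext1 :
  is_qdim (@syz_hom _ _ X M) (@syz_ext _ _ X M)
    (\dim (arrow_blocks pe M X) - \dim (cobd X M @: vertex_blocks M X))%N.
Proof.
apply: (is_qdim_image syz_of_der_linear syz_ext_subspace).
- apply/subvP => _ /memv_imgP[h hB ->]; exact: cobd_blocks.
- by move=> u uB; apply/syz_of_der_hom/der_of_Der.
- move=> h hL; exists (der_data pe (der_syz hL)).
    exact/der_data_blocks/der_syz_Der.
  rewrite der_dataK; [exact: syz_sub_der | exact: der_syz_Der].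
move=> u uB; split=> [|/memv_imgP[h hB ->]]; last first.
  rewrite der_of_cobd //; exact: syz_of_der_inner.
have dP := der_of_Der peP uB.
move=> /(inner_of_syz_ext dP)[f df].
have fC i x : act (e i) (f x) = f (act (e i) x).
  apply/eqP; rewrite -subr_eq0 -innerE -df (Der_vertex _ dP).
  by rewrite zero_lfunE.
apply/memv_imgP; exists (vertex_split f); first exact: vertex_split_blocks.
rewrite cobdE vertex_splitK; apply/ffunP => a.
by rewrite ffunE -df der_of_arrow.
Qed.

Lemma dimExt1E : (dimExt1 X M + \dim (cobd X M @: vertex_blocks M X) =
  \dim (arrow_blocks pe M X))%N.
Proof.
rewrite /dimExt1 (qdimP syz_ext_subspace is_qdim_Ext1) subnK //.
apply/dimvS/subvP => _ /memv_imgP[h hB ->]; exact: cobd_blocks.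
Qed.

(** The Euler form is the Euler characteristic of the two-term complex. *)
Lemma eulerE : euler X M =
  (\dim (vertex_blocks M X))%:Z - (\dim (arrow_blocks pe M X))%:Z.
Proof.
rewrite /euler /dimk (qdimP (is_subspace0 _) (is_qdim_Hom X M)) -dimExt1E.
rewrite -(limg_ker_dim (cobd X M) (vertex_blocks M X)) !PoszD.
by rewrite opprD addrACA subrr addr0.
Qed.

End Ext.
End Complex.

(** * One-point extensions *)

Section OnePoint.
Variables (k : fieldType) (Q : quiver) (A : kalgebra k) (pe : qpath Q -> A).
Hypothesis peP : path_basis pe.
Local Notation e := (vertex_elt pe).
Local Notation arr := (arrow_elt pe).

Lemma Der_pull (X Y M : fdmod A) (q : modhom Y X) (S : set A)
    (d : A -> 'Hom(X, M)) :
  Der S X M d -> Der S Y M (fun a => (d a \o q)%VF).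
Proof.
move=> dP; apply/DerP; split=> [a b|c b|a b y|s Ss]; last 1 first.
- by rewrite (derS dP Ss) comp_lfun0l.
- by rewrite (derD dP) comp_lfunDl.
- by rewrite (derZ dP) comp_lfunZl.
by rewrite !comp_lfunE (derM dP) mhomP.
Qed.

Variables (T M N : fdmod A) (V W : vectType k).
Variables (f : modhom (tens T V) M) (g : modhom (tens T W) N).
Local Notation B := (one_point_ext T).
Local Notation U := (tens T W).

Definition mx_a (a : A) : B := ((a, 0, 0) : op_space T).
Definition mx_t (x : T) : B := ((0, x, 0) : op_space T).
Definition mx_l (c : k) : B := ((0, 0, c) : op_space T).

Definition op_vertex (o : option (vertex Q)) : B :=
  if o is Some i then mx_a (e i) else mx_l 1.

Lemma mx_split (x : B) :
  x = mx_a (x : op_space T).1.1 + mx_t (x : op_space T).1.2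
    + mx_l (x : op_space T).2.
Proof.
by case: x => [[a t] l]; congr (_, _, _); rewrite /= !(addr0, add0r).
Qed.

Lemma mx_aD a b : mx_a (a + b) = mx_a a + mx_a b.
Proof. by congr (_, _, _); rewrite addr0. Qed.

Lemma mx_tD x y : mx_t (x + y) = mx_t x + mx_t y.
Proof. by congr (_, _, _); rewrite addr0. Qed.

Lemma mx_aM a b : mx_a (a * b) = mx_a a * mx_a b.
Proof.
by congr (_, _, _); rewrite /= ?mulr0 // linear0 scale0r addr0.
Qed.

Lemma mx_aT a x : mx_t (act a x) = mx_a a * mx_t x.
Proof.
by congr (_, _, _); rewrite /= ?mulr0 // scale0r addr0.
Qed.

Lemma mx_tl c x : mx_t (c *: x) = mx_t x * mx_l c.
Proof.
by congr (_, _, _); rewrite /= ?mul0r ?mulr0 // act0l add0r.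
Qed.

Lemma mx_aZ c a : mx_a (kscal A c * a) = kscal B c * mx_a a.
Proof.
by congr (_, _, _); rewrite /= ?mulr0 // linear0 scale0r addr0.
Qed.

Lemma mx_tZ c x : mx_t (c *: x) = kscal B c * mx_t x.
Proof.
by congr (_, _, _); rewrite /= ?mulr0 // actZ scale0r addr0.
Qed.

Lemma mx_lZ c : mx_l c = kscal B c * mx_l 1.
Proof.
by congr (_, _, _); rewrite /= ?mulr0 ?mulr1 // linear0 scaler0 addr0.
Qed.

Lemma pure0l (X : vectType k) (w : X) : pure (0 : T) w = 0.
Proof. by rewrite -(scale0r 0) pureZl scale0r. Qed.

Lemma pure0r (X : vectType k) (x : T) : pure x (0 : X) = 0.
Proof. by rewrite -(scale0r 0) pureZr scale0r. Qed.

Section TripleAction.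
Variables (L : fdmod A) (X : vectType k) (q : modhom (tens T X) L).
Implicit Types m : triple_mod q.

Lemma act_mx_a a m : act (mx_a a) m = ((act a m.1, 0) : L * X).
Proof. by congr (_, _); rewrite /= ?scale0r // pure0l linear0 addr0. Qed.

Lemma act_mx_t x m : act (mx_t x) m = ((q (pure x m.2), 0) : L * X).
Proof. by congr (_, _); rewrite /= ?scale0r // act0l add0r. Qed.

Lemma act_mx_l c m : act (mx_l c) m = ((0, c *: m.2) : L * X).
Proof. by congr (_, _); rewrite /= pure0l linear0 act0l addr0. Qed.

End TripleAction.

(** ** From quiver data to derivations of the extension *)

Definition op_der_fun (u : {ffun arrow Q -> 'Hom(N, M)}) (h : 'Hom(U, M))
    (x : B) (m : (N * W)%type) : (M * V)%type :=
  (der_of peP u (x : op_space T).1.1 m.1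
     + h (pure (x : op_space T).1.2 m.2), 0).

Lemma op_der_fun_linear u (h : 'Hom(U, M)) x : linear (op_der_fun u h x).
Proof.
move=> c m m'; congr (_, _); rewrite /= ?scaler0 ?addr0 //.
by rewrite linearP pureDr pureZr linearP scalerDr addrACA.
Qed.

Definition op_der u (h : 'Hom(U, M)) (x : B) : 'Hom(triple_mod g, triple_mod f) :=
  lfun_of (op_der_fun_linear u h x).

Lemma op_derE u (h : 'Hom(U, M)) x m : op_der u h x m = op_der_fun u h x m.
Proof. exact: lfun_ofE. Qed.

(** The compatibility of u and h is the Leibniz rule for the products a t. *)
Lemma op_der_Der u (h : 'Hom(U, M)) : u \in arrow_blocks pe M N ->
  (forall a z, h (act a z) = act a (h z) + der_of peP u a (g z)) ->
  Der (kspan op_vertex) (triple_mod g) (triple_mod f) (op_der u h).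
Proof.
move=> uB hP.
have dP := der_of_Der peP uB.
apply/DerP; split=> [a b|c b|a b m|_ [c ->]].
- apply/lfunP => m; rewrite add_lfunE !op_derE.
  congr (_, _); last by rewrite /= addr0.
  by rewrite /= (derD dP) add_lfunE pureDl linearD addrACA.
- apply/lfunP => m; rewrite scale_lfunE !op_derE.
  congr (_, _); last by rewrite /= scaler0.
  rewrite /= (derZ dP) scale_lfunE scaler0 addr0 actZ pureZl linearZ.
  by rewrite scalerDr.
- rewrite !op_derE; case: a b m => [[a t] l] [[b t'] l'] [n w].
  congr (_, _); last by rewrite /= scaler0 addr0.
  have hE : h (pure (act a t' + l' *: t) w) = act a (h (pure t' w))
      + der_of peP u a (g (pure t' w)) + h (pure t (l' *: w)).
    by rewrite pureDl linearD /= pure_act hP pureZl pureZr.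
  rewrite /= hE (derM dP) pure0r (linear0 f) addr0.
  rewrite (linearD (der_of peP u a)) /= actDr !addrA; congr (_ + _ + _).
  exact: addrAC.
have d0 : op_der u h 0 = 0.
  apply/lfunP => m; rewrite zero_lfunE op_derE; congr (_, _).
  by rewrite /= (der0 dP) zero_lfunE pure0l linear0 addr0.
have dD x y : op_der u h (x + y) = op_der u h x + op_der u h y.
  apply/lfunP => m; rewrite add_lfunE !op_derE.
  congr (_, _); last by rewrite /= addr0.
  by rewrite /= (derD dP) add_lfunE pureDl linearD addrACA.
rewrite (big_morph _ dD d0) big1 // => o _; apply/lfunP => m.
rewrite zero_lfunE op_derE; congr (_, _); case: o => [i|] /=.
  rewrite (derZ dP) (Der_vertex _ dP) scale_lfunE zero_lfunE scaler0.
  by rewrite linear0 scale0r addr0 pure0l linear0 addr0.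
by rewrite mulr0 (der0 dP) zero_lfunE linear0 scaler0 addr0 pure0l linear0 addr0.
Qed.

(** ** From derivations of the extension to quiver data *)

Section Components.
Variable d : B -> 'Hom(triple_mod g, triple_mod f).
Hypothesis dP : Der (kspan op_vertex) (triple_mod g) (triple_mod f) d.

Lemma Der_mx_l c : d (mx_l c) = 0.
Proof.
rewrite mx_lZ (derZ dP) (derS dP) ?scaler0 //.
exact: (kspan_gen op_vertex None).
Qed.

Lemma Der_mx_vertex i : d (mx_a (e i)) = 0.
Proof. by apply: (derS dP); apply: (kspan_gen op_vertex (Some i)). Qed.

Lemma Der_mx_1 : d (mx_a 1) = 0.
Proof.
rewrite -(pb_one peP) (big_morph mx_a mx_aD (erefl _ : mx_a 0 = 0)).
rewrite (der_sum dP) big1 // => i _; exact: Der_mx_vertex.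
Qed.

(** As d kills the idempotent E = [mx_a 1], it satisfies d(E x) = E d(x). *)
Lemma Der_mx_corner x m :
  mx_a 1 * x = x -> d x m = (((d x m).1, 0) : M * V).
Proof.
move=> xE; rewrite -{1}xE (derM dP) Der_mx_1 zero_lfunE addr0 act_mx_a.
by rewrite act1.
Qed.

Lemma Der_mx_a a m : d (mx_a a) m = (((d (mx_a a) (m.1, 0)).1, 0) : M * V).
Proof.
rewrite Der_mx_corner; last by rewrite -mx_aM mul1r.
rewrite -{1}[a]mulr1 mx_aM (derM dP) Der_mx_1 zero_lfunE linear0 add0r.
by rewrite act_mx_a act1.
Qed.

Lemma Der_mx_t x m : d (mx_t x) m = (((d (mx_t x) (0, m.2)).1, 0) : M * V).
Proof.
rewrite Der_mx_corner; last by rewrite -mx_aT act1.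
rewrite -{1}[x]scale1r mx_tl (derM dP) Der_mx_l zero_lfunE linear0 add0r.
by rewrite act_mx_l scale1r.
Qed.

Lemma der_a_linear a : linear (fun n : N => (d (mx_a a) (n, 0)).1 : M).
Proof.
move=> c n n'.
have -> : ((c *: n + n', 0) : N * W) = c *: ((n, 0) : N * W) + (n', 0).
  by congr (_, _); rewrite /= scaler0 addr0.
by rewrite linearP.
Qed.

Definition der_a a : 'Hom(N, M) := lfun_of (der_a_linear a).

Lemma der_aE a n : der_a a n = (d (mx_a a) (n, 0)).1.
Proof. exact: lfun_ofE. Qed.

Lemma der_a_Der : Der (vertex_span pe) N M der_a.
Proof.
have dD a b : der_a (a + b) = der_a a + der_a b.
  by apply/lfunP => n; rewrite add_lfunE !der_aE mx_aD (derD dP) add_lfunE.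
have dZ c b : der_a (kscal A c * b) = c *: der_a b.
  by apply/lfunP => n; rewrite scale_lfunE !der_aE mx_aZ (derZ dP) scale_lfunE.
have d0 : der_a 0 = 0 by apply: (addIr (der_a 0)); rewrite -dD !add0r.
apply/DerP; split=> // [a b n|_ [c ->]].
  by rewrite !der_aE mx_aM (derM dP) !act_mx_a.
rewrite (big_morph _ dD d0) big1 // => i _; rewrite dZ.
apply/lfunP => n.
by rewrite scale_lfunE der_aE Der_mx_vertex zero_lfunE scaler0 zero_lfunE.
Qed.

Lemma der_t_exists : exists h : 'Hom(U, M),
  forall x w, h (pure x w) = (d (mx_t x) (0, w)).1.
Proof.
have [x c w w'|w c x x'|h [hE _]] :=
  @tens_univ k A T W M (fun x w => (d (mx_t x) (0, w)).1).
- have -> : ((0, c *: w + w') : N * W) = c *: ((0, w) : N * W) + (0, w').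
    by congr (_, _); rewrite /= scaler0 addr0.
  by rewrite linearP.
- by rewrite mx_tD mx_tZ (derD dP) (derZ dP) add_lfunE scale_lfunE.
by exists h.
Qed.

Lemma op_der_components (h : 'Hom(U, M)) :
  (forall x w, h (pure x w) = (d (mx_t x) (0, w)).1) ->
  (forall a z, h (act a z) = act a (h z) + der_a a (g z)) /\
  op_der (der_data pe der_a) h = d.
Proof.
move=> hE; split=> [a z|].
  have : (h \o actf U a)%VF = ((actf M a \o h) + (der_a a \o g))%VF.
    apply: tens_eq => x w; rewrite add_lfunE !comp_lfunE !actfE -pure_act !hE.
    rewrite mx_aT (derM dP) act_mx_t der_aE /=.
    by rewrite pure0l linear0 addr0.
  move=> /lfunP/(_ z); by rewrite add_lfunE !comp_lfunE !actfE.
apply/funext => x; apply/lfunP => m; rewrite op_derE [in RHS](mx_split x).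
rewrite !(derD dP) Der_mx_l addr0 add_lfunE Der_mx_a Der_mx_t.
rewrite /op_der_fun (der_dataK peP der_a_Der) der_aE hE.
by congr (_, _); rewrite /= addr0.
Qed.

End Components.

(** ** The dimension of the space of derivations *)

Definition op_der_pair
    (x : ({ffun arrow Q -> 'Hom(N, M)} * {ffun vertex Q -> 'Hom(U, M)})%type) :=
  op_der x.1 (block_sum x.2).

Lemma op_der_pair_linear : linear op_der_pair.
Proof.
move=> c x y; apply/funext => b; apply/lfunP => m.
change (op_der_pair (c *: x + y) b m =
  (c *: op_der_pair x b + op_der_pair y b) m).
rewrite add_lfunE scale_lfunE !op_derE; congr (_, _); last first.
  by rewrite /= scaler0 addr0.
rewrite /= block_sum_linear !(add_lfunE, scale_lfunE).
have -> : der_of peP (c *: x.1 + y.1) b.1.1 m.1 =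
    c *: der_of peP x.1 b.1.1 m.1 + der_of peP y.1 b.1.1 m.1.
  rewrite der_of_linear.
  change ((c *: der_of peP x.1 b.1.1 + der_of peP y.1 b.1.1) m.1 =
    c *: der_of peP x.1 b.1.1 m.1 + der_of peP y.1 b.1.1 m.1).
  by rewrite add_lfunE scale_lfunE.
by rewrite scalerDr addrACA.
Qed.

Local Notation pullg := (pull (arrow Q) M g).

(** Both conditions say that two derivations with values in Hom(U, M) agree:
    the pull-back of the derivation of N, and minus the inner one of h. *)
Lemma compatibleP u h : u \in arrow_blocks pe M N -> h \in vertex_blocks pe M U ->
  pullg u + cobd pe U M h = 0 <->
  forall a z,
    block_sum h (act a z) = act a (block_sum h z) + der_of peP u a (g z).
Proof.
move=> uB hB.
have E a z : (pullg u + cobd pe U M h) a z = u a (g z)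
    + (act (arr a) (block_sum h z) - block_sum h (act (arr a) z)).
  by rewrite ffunE add_lfunE pullE cobdE ffunE innerE.
split=> [uh0 a z|hP].
  have ihP : Der (vertex_span pe) U M (inner (- block_sum h)).
    apply: inner_Der => i y.
    by rewrite !opp_lfunE linearN /= (block_sum_comm peP _ _ hB).
  have ug a' : (der_of peP u (arr a') \o g)%VF = inner (- block_sum h) (arr a').
    apply/lfunP => y; rewrite comp_lfunE der_of_arrow // innerE !opp_lfunE.
    rewrite linearN /=; apply/eqP; rewrite -subr_eq0 opprD !opprK -E uh0.
    by rewrite ffunE zero_lfunE.
  have /lfunP/(_ z) := Der_eq peP (Der_pull g (der_of_Der peP uB)) ihP ug a.
  rewrite comp_lfunE => ->; rewrite innerE !opp_lfunE linearN /= opprK.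
  by rewrite addrA subrr add0r.
apply/ffunP => a; apply/lfunP => z; rewrite E hP der_of_arrow //.
by rewrite ffunE zero_lfunE opprD addNKr subrr.
Qed.

Lemma is_qdim_Der_op
    (P : {vspace ({ffun arrow Q -> 'Hom(N, M)}
                  * {ffun vertex Q -> 'Hom(U, M)})%type}) :
  (forall x, (x \in P) = [&& x.1 \in arrow_blocks pe M N,
     x.2 \in vertex_blocks pe M U & pullg x.1 + cobd pe U M x.2 == 0]) ->
  is_qdim (Der (kspan op_vertex) (triple_mod g) (triple_mod f)) [set 0]%classic
    (\dim P).
Proof.
move=> memP; apply: (is_qdim_isom op_der_pair_linear) => [x|d dP|x].
- rewrite memP => /and3P[uB hB /eqP/(compatibleP uB hB) hP].
  exact: op_der_Der.
- have [h hE] := der_t_exists dP.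
  have [hP dE] := op_der_components dP hE.
  have aP := der_a_Der dP.
  exists (der_data pe (der_a d), vertex_split pe h); last first.
    by rewrite /op_der_pair /= vertex_splitK.
  have uB := der_data_blocks peP aP.
  have hB : vertex_split pe h \in vertex_blocks pe M U.
    apply: (vertex_split_blocks peP) => i z.
    by rewrite hP (Der_vertex _ aP) zero_lfunE addr0.
  rewrite memP /= uB hB; apply/eqP/(compatibleP uB hB) => a z.
  by rewrite (vertex_splitK peP) (der_dataK peP aP).
rewrite memP => /and3P[uB hB _] x0.
have d0 b m : op_der_fun x.1 (block_sum x.2) b m = 0.
  rewrite -op_derE -[op_der _ _]/(op_der_pair x) x0.
  exact: zero_lfunE.
have u0 : x.1 = 0.
  apply/ffunP => a; apply/lfunP => n; rewrite ffunE zero_lfunE.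
  have := congr1 fst (d0 (mx_a (arr a)) (n, 0)).
  by rewrite /= pure0l linear0 addr0 der_of_arrow.
have h0 : block_sum x.2 = 0.
  apply: tens_eq => t w; rewrite zero_lfunE.
  have := congr1 fst (d0 (mx_t t) (0, w)).
  by rewrite /= linear0 add0r.
rewrite [x]surjective_pairing u0; congr (_, _); apply/ffunP => i.
apply/lfunP => z; rewrite -(block_sum_tgt peP _ _ hB) h0.
by rewrite ffunE !zero_lfunE linear0.
Qed.

Lemma ker_in_linear : linear (fun z : ker_mod g => vsval z : U).
Proof. by move=> c x y; rewrite linearP. Qed.

Fact ker_in_hom : Defs.Hom (ker_mod g) U (lfun_of ker_in_linear).
Proof. by move=> b z; rewrite [LHS]lfun_ofE [in RHS]lfun_ofE ker_actE. Qed.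

Definition ker_in : modhom (ker_mod g) U := ModHom ker_in_hom.

Lemma ker_inE z : ker_in z = vsval z. Proof. exact: lfun_ofE. Qed.

Lemma cobd_pull (X Y : fdmod A) (q : modhom Y X) h :
  cobd pe Y M (pull (vertex Q) M q h) = pull (arrow Q) M q (cobd pe X M h).
Proof.
have gE z : block_sum (pull (vertex Q) M q h) z = block_sum h (q z).
  by rewrite !block_sumE; apply: eq_bigr => i _; rewrite pullE.
apply/ffunP => a; apply/lfunP => y.
by rewrite pullE !cobdE !ffunE !innerE !gE mhomP.
Qed.

(** Ext^1(ker g, M) is the cokernel of g^* : Der(N, M) -> Ext^1(U, M), as
    restriction to ker g is onto on arrow blocks, with kernel the blocks that
    factor through g. *)
Lemma dim_coker_pull :
  (\dim (arrow_blocks pe M U) =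
   \dim (pullg @: arrow_blocks pe M N + cobd pe U M @: vertex_blocks pe M U)
   + dimExt1 (ker_mod g) M)%N.
Proof.
set G := (_ @: _ + _)%VS.
have ker_inI : injective ker_in by move=> z z'; rewrite !ker_inE => /val_inj.
have GB : (G <= arrow_blocks pe M U)%VS.
  rewrite subv_add; apply/andP; split; apply/subvP => _ /memv_imgP[x xB ->].
    exact: pull_blocks.
  exact: (cobd_blocks peP).
have kG : (arrow_blocks pe M U :&: lker (pull (arrow Q) M ker_in) <= G)%VS.
  apply/subvP => v /memv_capP[vB]; rewrite memv_ker => /eqP v0.
  have [a z gz|u uB <-] := pull_factor peP (q := g) vB.
    have zK : z \in lker g by rewrite memv_ker gz.
    have -> : z = ker_in (vsproj (lker g) z) by rewrite ker_inE vsprojK.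
    by rewrite -pullE v0 ffunE zero_lfunE.
  by apply: (subvP (addvSl _ _)); apply: memv_img.
have := dimv_quotient_image GB kG.
rewrite (pull_onto peP _ _ _ ker_inI) -/(arrow_blocks _ _ _).
have -> : (pull (arrow Q) M ker_in @: G =
    cobd pe (ker_mod g) M @: vertex_blocks pe M (ker_mod g))%VS.
  rewrite /G limgD -!limg_comp.
  have -> : ((pull (arrow Q) M ker_in \o pullg) @: arrow_blocks pe M N = 0)%VS.
    apply/eqP; rewrite -lkerE; apply/subvP => u _; rewrite memv_ker comp_lfunE.
    apply/eqP/ffunP => a; apply/lfunP => z; rewrite !pullE ffunE zero_lfunE.
    rewrite ker_inE (_ : g (vsval z) = 0) ?linear0 //.
    by apply/eqP; rewrite -memv_ker subvsP.
  rewrite add0v.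
  rewrite -[vertex_blocks pe M (ker_mod g)](pull_onto peP id id M ker_inI).
  rewrite -limg_comp.
  by apply: eq_in_limg => h _; rewrite !comp_lfunE cobd_pull.
rewrite -(dimExt1E peP (ker_mod g) M) addnA => /addIn ->.
by [].
Qed.

Lemma dim_Der_one_point :
  [/\ finite_dimk (Der (kspan op_vertex) (triple_mod g) (triple_mod f)),
      finite_dimk (Der (vertex_span pe) N M),
      finite_Ext1 T M,
      finite_Ext1 (ker_mod g) M &
      (dimk (Der (kspan op_vertex) (triple_mod g) (triple_mod f)))%:Z
        = (dimk (Der (vertex_span pe) N M))%:Z
          + (\dim {:W})%:Z * euler T M
          + (dimExt1 (ker_mod g) M)%:Z].
Proof.
have [P [memP dimP]] := dim_fibre_product pullg (cobd pe U M)
  (arrow_blocks pe M N) (vertex_blocks pe M U).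
have qP := is_qdim_Der_op memP.
split.
- by exists (\dim P).
- by exists (\dim (arrow_blocks pe M N)); apply: is_qdim_Der.
- by eexists; apply: (is_qdim_Ext1 peP).
- by eexists; apply: (is_qdim_Ext1 peP).
rewrite /dimk (qdimP (is_subspace0 _) qP).
rewrite (qdimP (is_subspace0 _) (is_qdim_Der peP N M)) (eulerE peP T M).
have := dim_coker_pull.
have vU : (\dim (vertex_blocks pe M U) =
    \dim {:W} * \dim (vertex_blocks pe M T))%N by exact: dim_blocks_tens.
have aU : (\dim (arrow_blocks pe M U) =
    \dim {:W} * \dim (arrow_blocks pe M T))%N by exact: dim_blocks_tens.
move=> cE; rewrite mulrBr -!PoszM -vU -aU cE PoszD.
have -> : (\dim P)%:Z = (\dim (arrow_blocks pe M N))%:Z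
    + (\dim (vertex_blocks pe M U))%:Z
    - (\dim (pullg @: arrow_blocks pe M N
        + cobd pe U M @: vertex_blocks pe M U))%:Z.
  by rewrite -PoszD -dimP PoszD addrK.
by rewrite opprD !addrA subrK.
Qed.

End OnePoint.

Theorem theorem3p7 (k : closedFieldType) (Q : quiver)
    (T M N : fdmod (path_algebra k Q)) (V W : vectType k)
    (f : modhom (tens T V) M) (g : modhom (tens T W) N) :
  [/\ finite_dimk (Der (op_subalg T) (triple_mod g) (triple_mod f)),
      finite_dimk (Der (vertex_subalg k Q) N M),
      finite_Ext1 T M,
      finite_Ext1 (ker_mod g) M &
      (dimk (Der (op_subalg T) (triple_mod g) (triple_mod f)))%:Z
        = (dimk (Der (vertex_subalg k Q) N M))%:Z
          + (\dim {:W})%:Z * euler T M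
          + (dimExt1 (ker_mod g) M)%:Z].
Proof. exact: (dim_Der_one_point (path_algebra_basis k Q)). Qed.
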